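(* Let $F$ be a field of characteristic $2$, let $n\ge 2$ be an integer, and let $\mathfrak b$ be an anisotropic symmetric bilinear form over $F$ of dimension $2^n+2^{n-1}$. Then $[\mathfrak b]\in I^n(F)$ if and only if $\mathfrak b\simeq \mathfrak c\otimes\mathfrak d$ for some $(n-2)$-fold bilinear Pfister form $\mathfrak c$ and some Albert form $\mathfrak d$ over $F$.
   Context: A symmetric bilinear form over a field $K$ is a finite-dimensional $K$-vector space $V$ with a non-degenerate symmetric bilinear map $\mathfrak b:V\times V\to K$; it is anisotropic if $\mathfrak b(v,v)\neq 0$ for all $v\ne 0$. $\langle a_1,\dots,a_m\rangle_b$ denotes the diagonal form $\sum a_i x_iy_i$. For $a_1,\dots,a_m\in K^\times$, the $m$-fold bilinear Pfister form is $\langle\langle a_1,\dots,a_m\rangle\rangle_b=\langle 1,a_1\rangle_b\otimes\cdots\otimes\langle 1,a_m\rangle_b$ (the $0$-fold one is $\langle 1\rangle_b$). $W(K)$ is the Witt ring of symmetric bilinear forms over $K$, $[\mathfrak b]$ the class of $\mathfrak b$, $I(K)$ the fundamental ideal (classes of even-dimensional forms), and $I^n(K)$ its $n$-th power. An Albert form is a $6$-dimensional symmetric bilinear form of trivial determinant (determinant taken in $K^\times/K^{\times2}$). *)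

(* Defs.v *)
(* Symmetric bilinear forms over a field F are represented by
   their Gram matrices with respect to a basis. *)
From mathcomp Require Import all_boot all_algebra.
From mathcomp Require Export mxtens.
Set Implicit Arguments. Unset Strict Implicit. Unset Printing Implicit Defensive.
Import GRing.Theory.
Local Open Scope ring_scope.

Section Forms.
Variable F : fieldType.

Definition symform m (A : 'M[F]_m) : Prop := A^T = A /\ A \in unitmx.

Definition anisotropic m (A : 'M[F]_m) : Prop :=
  forall v : 'rV[F]_m, v != 0 -> (v *m A *m v^T) 0 0 != 0.

(* isometry of forms of possibly different (a priori) dimensions:
   an invertible change of basis P with  P B P^T = A *)
Definition iso m n (A : 'M[F]_m) (B : 'M[F]_n) : Prop :=
  exists (P : 'M[F]_(m, n)) (Q : 'M[F]_(n, m)),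
    P *m Q = 1%:M /\ Q *m P = 1%:M /\ P *m B *m P^T = A.

Definition osum m n (A : 'M[F]_m) (B : 'M[F]_n) : 'M[F]_(m + n) :=
  block_mx A 0 0 B.

(* metabolic: non-degenerate symmetric with a totally isotropic subspace
   (row space of W) of half the dimension *)
Definition metabolic m (A : 'M[F]_m) : Prop :=
  symform A /\ exists W : 'M[F]_m, (\rank W * 2)%N = m /\ W *m A *m W^T = 0.

(* the k-fold bilinear Pfister form <<a_0,...,a_{k-1}>>_b
   = <1,a_0> (x) ... (x) <1,a_{k-1}>, as a diagonal form on 2^k basis
   vectors indexed by i < 2^k: the i-th diagonal entry is the product of
   the a_j over the bits j set in i. *)
Definition pfister k (a : 'I_k -> F) : 'M[F]_(2 ^ k) :=
  diag_mx (\row_(i < 2 ^ k) \prod_(j < k | odd (i %/ 2 ^ j)) a j).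

Definition albert (D : 'M[F]_6) : Prop :=
  symform D /\ exists c : F, \det D = c ^+ 2.

(* Witt class of B lies in I^n(F): I^n(F) is (additively) the set of finite
   sums of scalar multiples s * pi of n-fold bilinear Pfister forms pi, and
   [B] = [S] in W(F) iff B _|_ M1 ~= S _|_ M2 with M1, M2 metabolic. *)
Definition in_In n m (B : 'M[F]_m) : Prop :=
  exists (k : nat) (s : 'I_k -> F) (a : 'I_k -> 'I_n -> F),
    (forall i, s i != 0) /\ (forall i j, a i j != 0) /\
    exists (m1 m2 : nat) (M1 : 'M[F]_m1) (M2 : 'M[F]_m2),
      metabolic M1 /\ metabolic M2 /\
      iso (osum B M1)
          (osum (mxdiag (fun i : 'I_k => s i *: pfister (a i))) M2).

End Forms.

(* Main.v *)
(* In characteristic 2, v |-> b(v, v) is additive, Frobenius-semilinear and, for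
   b anisotropic, injective.  Identifying v with b(v, v), b lives on a subspace V
   of a finite extension M = F^2(S) of F^2 inside F.  Fix a nonzero
   linear s : M -> F^2.  Then b corresponds to the operator T on M with image V
   that is symmetric for s(xy) and satisfies s(x T(x)) = T(x); orthogonal sums
   become sums of operators, metabolic forms become 0, and <<a>> b becomes
   T + a T a^-1, which vanishes exactly when a commutes with T.  Thus iterated
   multiplication by Pfister forms produces operators commuting with larger and
   larger subfields of M, and as [M : F^2] is finite, statements on I^n can be
   proved by downward induction on n.

   Let T lie in I^n with 2^n < rank T <= 3 * 2^(n-1).  For a pair v, w in V that
   maximizes dim (v V + w V), the operator of <<w/v>> b has rank exactly 2^(n+1),
   so its image is a line over a subfield of degree 2^(n+1).  Either it contains
   V, and T commutes with a field of degree 2^(n-1), or comparing two such pairs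
   yields an n-fold Pfister summand having most of V in common with b.  It follows
   that rank T = 3 * 2^(n-1) and that T is a sum of two general n-fold Pfister
   forms; their images are lines wZ1, wZ2 over subfields, and a common subfield of
   degree 2^(n-2) on which they agree gives the common (n-2)-fold factor. *)
From HB Require Import structures.
Require Import Defs.
From mathcomp Require Import all_boot all_order all_fingroup all_algebra all_field.
From mathcomp Require Import zify ring.
From Stdlib Require Import Classical ClassicalEpsilon FunctionalExtensionality PropExtensionality.
Set Implicit Arguments. Unset Strict Implicit. Unset Printing Implicit Defensive.
Import GRing.Theory.
Local Open Scope ring_scope.

(** The obstacle is to control <<a>> b when a = w/v is a ratio of two vectors of V. The subspaces V
    and aV share a nonzero vector, so <<a>> b has rank below 2 rank T <= 3 * 2^n. Membership in
    I^(n+1) bounds a nonzero rank from below by 2^(n+1), and the ranks strictly in between are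
    excluded by a gap statement for n + 1, proved within the same downward induction. Maximality of
    the pair v, w acts as a first-order condition: if v x + w y = 0 with x, y in V, then v' x + w' y
    stays in vV + wV for all v', w' in V. In characteristic 2 each x common to V and aV gives such a
    relation, with y = x/a. Hence V + aV is a module over a field containing x/v for all these x,
    and divisibility of its dimension by a power of 2 leaves only the two alternatives. Perturbing
    maximal pairs needs infinitely many scalars; a finite F is perfect and has no anisotropic form
    of dimension above 1. *)

(** * Diagonal matrices, binary digits and subspaces given by predicates *)

Lemma mxdiag_diag (V : nzRingType) q (p : 'I_q -> nat) (e : forall i, 'rV[V]_(p i)) :
  mxdiag (fun i => diag_mx (e i)) =
  diag_mx (\row_l e (tagnat.sig1 l) 0 (tagnat.sig2 l)).
Proof.
have /diag_mxP[d dE] : is_diag_mx (mxdiag (fun i => diag_mx (e i))).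
  apply/is_diag_mxblockP; split=> [i j /negPf-> // | i].
  by rewrite eqxx conform_mx_id diag_mx_is_diag.
rewrite dE; congr diag_mx; apply/rowP=> l; rewrite mxE.
move/matrixP/(_ l l): dE; rewrite [RHS]mxE eqxx mulr1n => <-.
by rewrite mxE eqxx conform_mx_id mxE eqxx.
Qed.

Lemma tens_diag (V : nzRingType) m n (d : 'rV[V]_m) (e : 'rV[V]_n) :
  diag_mx d *t diag_mx e =
  diag_mx (\row_l (d 0 (mxtens_unindex l).1 * e 0 (mxtens_unindex l).2)).
Proof.
apply/matrixP=> i j; case: (mxtens_indexP i) => i1 i2; case: (mxtens_indexP j) => j1 j2.
rewrite tensmxE !mxE mxtens_indexK /=.
rewrite (can_eq (@mxtens_indexK m n)) xpair_eqE.
by case: eqP => [->|_]; case: eqP => [->|_]; rewrite ?mulr1n ?mulr0n ?mulr0 ?mul0r.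
Qed.

Lemma diag_mx_unit (K : fieldType) m (d : 'rV[K]_m) :
  (forall i, d 0 i != 0) -> diag_mx d \in unitmx.
Proof. by move=> nzd; rewrite unitmxE det_diag unitfE; apply/prodf_neq0. Qed.

Lemma bits_prod_low (K : fieldType) (n i : nat) (f : nat -> K) : (i < 2 ^ n)%N ->
  \prod_(j < n.+1 | odd (i %/ 2 ^ j)) f j = \prod_(j < n | odd (i %/ 2 ^ j)) f j.
Proof.
by move=> lt_i; rewrite big_mkcond big_ord_recr /= divn_small //= mulr1 -big_mkcond.
Qed.

Lemma bits_prod_high (K : fieldType) (n i : nat) (f : nat -> K) : (i < 2 ^ n)%N ->
  \prod_(j < n.+1 | odd ((i + 2 ^ n) %/ 2 ^ j)) f j =
  f n * \prod_(j < n | odd (i %/ 2 ^ j)) f j.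
Proof.
move=> lt_i; rewrite big_mkcond big_ord_recr /= mulrC; congr (_ * _).
  by rewrite -[X in (_ + X)%N]mul1n divnDMl ?expn_gt0 // divn_small.
rewrite -big_mkcond; apply: eq_bigl => j.
have -> : (2 ^ n = 2 ^ (n - j) * 2 ^ j)%N by rewrite -expnD subnK // ltnW.
rewrite divnDMl ?expn_gt0 // oddD oddX orbF.
by rewrite subn_eq0 leqNgt ltn_ord addbF.
Qed.

Lemma big_halves (R : Type) (idx : R) (op : Monoid.law idx) n (f : nat -> R) :
  \big[op/idx]_(i < 2 ^ n.+1) f i =
  op (\big[op/idx]_(i < 2 ^ n) f i) (\big[op/idx]_(i < 2 ^ n) f (i + 2 ^ n)%N).
Proof.
rewrite expnS mul2n -addnn big_split_ord /=; congr (op _ _).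
by apply: eq_bigr => i _; rewrite addnC.
Qed.

(** A subspace inside P is enlarged by missing vectors of P until none is left; the codimension
    bounds the number of steps, and excluded middle decides whether to stop. *)
Lemma vspace_of_pred (K : fieldType) (vT : vectType K) (P : vT -> Prop) :
  P 0 -> (forall c u v, P u -> P v -> P (c *: u + v)) ->
  exists U : {vspace vT}, forall x, x \in U <-> P x.
Proof.
move=> P0 Plin.
have ext n : forall U : {vspace vT}, (forall x, x \in U -> P x) ->
    (\dim {:vT} - \dim U <= n)%N ->
  exists U : {vspace vT}, forall x, x \in U <-> P x.
  elim: n => [|n IHn] U sUP dimU.
    exists U => x; split=> [/sUP //|_].
    have /eqP-> : (U == fullv)%VS; last exact: memvf.
    by rewrite eqEdim subvf /=; lia.
  have [sPU | nsPU] := classic (forall x, P x -> x \in U).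
    by exists U => x; split; [apply: sUP | apply: sPU].
  have [x nPx] := not_all_ex_not _ _ nsPU.
  have [Px /negP xU] := imply_to_and _ _ nPx.
  apply: (IHn (U + <[x]>)%VS).
    move=> _ /memv_addP[u uU [_ /vlineP[c ->] ->]].
    by rewrite addrC; apply: Plin => //; apply: sUP.
  have lt : (\dim U < \dim (U + <[x]>))%N.
    rewrite ltnNge; apply: contra xU => le.
    have : (U == U + <[x]>)%VS by rewrite eqEdim addvSl.
    by move/eqP->; rewrite memvE addvSr.
  have := dimvS (subvf (U + <[x]>)%VS); lia.
apply: (ext _ 0%VS _ (leqnn _)) => x; rewrite memv0 => /eqP-> //.
Qed.

(** * Purely inseparable extensions *)

(* M models an extension F^2(S) of F^2 inside k = F: a scalar c acts as
   multiplication by c^2 and iota is the inclusion of M in k. *)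
Section InseparableField.

Variables (k : fieldType) (M : fieldExtType k) (iota : {rmorphism M -> k}).
Hypothesis iotaP : forall x : M, x * x = (iota x)%:A.
Hypothesis char2 : 2%N \in [pchar k].

Definition dm (U : {vspace M}) : nat := \dim U.

(* Canonical structure paths to the vector space M may differ syntactically
   between lemmas; folding every dimension into [dm] lets [lia] identify them. *)
Ltac dlia := repeat match goal with
  | H : context[@dimv ?K ?V ?U] |- _ => change (@dimv K V U) with (dm U) in H
  | |- context[@dimv ?K ?V ?U] => change (@dimv K V U) with (dm U)
  end; lia.

Lemma addkk (x : k) : x + x = 0.
Proof. exact: addrr_pchar2. Qed.

Lemma addMM (x : M) : x + x = 0.
Proof. by rewrite -[x]scale1r -scalerDl addkk scale0r. Qed.

Lemma oppM (x : M) : - x = x.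
Proof. by apply/eqP; rewrite eq_sym -addr_eq0 addMM. Qed.

Lemma oppk (x : k) : - x = x.
Proof. by apply/eqP; rewrite eq_sym -addr_eq0 addkk. Qed.

Lemma iota_eq0 (x : M) : (iota x == 0) = (x == 0).
Proof. exact: fmorph_eq0. Qed.

Lemma iotaZ (c : k) (x : M) : iota (c *: x) = c ^+ 2 * iota x.
Proof.
have iotaA : iota c%:A = c ^+ 2.
  apply: (fmorph_inj (in_alg M)); rewrite /= -iotaP.
  by rewrite -scalerAl mul1r scalerA expr2.
by rewrite -mulr_algl rmorphM /= iotaA.
Qed.

(** Squares are scalars, so an inverse is a scalar multiple of the element itself and every subspace
    is stable under inversion. *)
Lemma invM (x : M) : x^-1 = (iota x)^-1 *: x.
Proof.
have [-> | nz] := eqVneq x 0; first by rewrite invr0 scaler0.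
apply: (mulfI nz); rewrite mulfV // -scalerAr iotaP scalerA mulVf ?scale1r //.
by rewrite iota_eq0.
Qed.

Lemma memV_inv (U : {vspace M}) x : x \in U -> x^-1 \in U.
Proof. by move=> Ux; rewrite invM memvZ. Qed.

Lemma subfield_of_pred (P : M -> Prop) :
  P 1 -> (forall c u v, P u -> P v -> P (c *: u + v)) ->
  (forall u v, P u -> P v -> P (u * v)) ->
  exists E : {subfield M}, forall x, x \in E <-> P x.
Proof.
move=> P1 Plin Pmul.
have P0 : P 0 by have := Plin (-1) 1 1 P1 P1; rewrite scaleN1r addNr.
have [U PU] := vspace_of_pred P0 Plin.
have aU : is_aspace U.
  rewrite /is_aspace has_algid1 /=; last by apply/PU.
  by apply/prodvP=> u v /PU Pu /PU Pv; apply/PU/Pmul.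
by exists (ASpace aU).
Qed.

Lemma dim_Fadjoin2 (E : {subfield M}) x :
  x \notin E -> \dim <<E; x>> = (2 * \dim E)%N.
Proof.
move=> xE; rewrite dim_Fadjoin; congr (_ * _)%N.
have n1 : adjoin_degree E x != 1%N by rewrite adjoin_deg_eq1.
have n0 : (0 < adjoin_degree E x)%N by [].
suff : (adjoin_degree E x <= 2)%N by move: n0 n1; case: (adjoin_degree E x) => [|[|[|]]].
pose p : {poly M} := 'X^2 - ((iota x)%:A)%:P.
have sp : size p = 3 by rewrite size_XnsubC.
have Ep : p \is a polyOver E.
  by rewrite rpredB ?rpredX ?polyOverX // polyOverC memvZ ?mem1v.
have rp : root p x by rewrite /root !hornerE -iotaP expr2 subrr.
have p0 : p != 0 by rewrite -size_poly_eq0 sp.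
by have := dvdp_leq p0 (minPoly_dvdp Ep rp); rewrite sp size_minPoly ltnS.
Qed.

(** Adjoining one element doubles the degree because its square is a scalar, so intermediate fields
    of every 2-power degree occur. *)
Lemma subfield_tower (E E' : {subfield M}) : (E <= E')%VS ->
  exists m, \dim E' = (2 ^ m * \dim E)%N /\
    forall i, (i <= m)%N -> exists E'' : {subfield M},
      [/\ (E <= E'')%VS, (E'' <= E')%VS & \dim E'' = (2 ^ i * \dim E)%N].
Proof.
have [n le_n] := ubnP (\dim E' - \dim E)%N.
elim: n => // n IHn in E le_n *; move=> sEE'.
have [sE'E | /subvPn[x xE' xE]] := boolP (E' <= E)%VS.
  have eqE : E' = E :> {vspace M} by apply: subv_anti; rewrite sE'E sEE'.
  exists 0%N; rewrite expn0 mul1n eqE; split=> // i; rewrite leqn0 => /eqP->.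
  by exists E; rewrite mul1n -{2}eqE.
have sF : (<<E; x>> <= E')%VS by apply/FadjoinP.
have dF := dim_Fadjoin2 xE; have := dimvS sF => le_d.
have dE : (0 < \dim E)%N by rewrite adim_gt0.
case: (IHn <<E; x>>%AS _ sF) => [|m [dE' chain]]; first by rewrite /= dF; lia.
rewrite dF mulnA -expnSr in dE'; exists m.+1; split=> // -[|i] le_i.
  by exists E; rewrite mul1n.
have [E'' [sFE'' sE''E' dE'']] := chain i le_i.
exists E''; split=> //; first by apply: subv_trans sFE''; apply: subv_adjoin.
by rewrite dE'' dF mulnA -expnSr.
Qed.

Lemma dim_subfield (E : {subfield M}) : exists j, \dim E = (2 ^ j)%N.
Proof.
have [m [-> _]] := subfield_tower (sub1v E); exists m.
by rewrite dimv1 muln1.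
Qed.

Lemma subfieldM (E : {subfield M}) a b : a \in E -> b \in E -> a * b \in E.
Proof. by move=> Ea Eb; rewrite -(prodv_id E) memv_mul. Qed.

Definition coset (U : {vspace M}) (w : M) : {vspace M} := (U * <[w]>)%VS.

Lemma mem_coset (U : {vspace M}) w x : w != 0 -> (x \in coset U w) = (x / w \in U).
Proof.
move=> nzw; apply/idP/idP.
  by case/memv_cosetP=> u Uu ->; rewrite mulfK.
by move=> Ux; rewrite -[x](divfK nzw) memv_mul ?memv_line.
Qed.

Lemma dim_coset (U : {vspace M}) w : w != 0 -> \dim (coset U w) = \dim U.
Proof. exact: dim_cosetv. Qed.

Lemma vspaceM_eq (U W : {vspace M}) : (forall x : M, (x \in U) = (x \in W)) -> U = W.
Proof. by move=> UW; apply/vspaceP. Qed.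

Lemma sumvP (U W : {vspace M}) (x : M) :
  reflect (exists2 u : M, u \in U & exists2 w : M, w \in W & x = u + w)
    (x \in (U + W)%VS).
Proof. exact: memv_addP. Qed.

Lemma cosetP (U : {vspace M}) (w x : M) :
  reflect (exists2 u : M, u \in U & x = u * w) (x \in coset U w).
Proof. exact: memv_cosetP. Qed.

Lemma coset0 (U : {vspace M}) : coset U 0 = 0%VS.
Proof.
apply/eqP; rewrite -subv0; apply/subvP=> _ /cosetP[x _ ->].
by rewrite mulr0 mem0v.
Qed.

Lemma mem_coset_mul (U : {vspace M}) x w : x \in U -> x * w \in coset U w.
Proof. by move=> Ux; rewrite /coset memv_mul ?memv_line. Qed.

Lemma dim_gt0 (U : {vspace M}) x : x \in U -> x != 0 -> (0 < \dim U)%N.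
Proof.
by move=> Ux nzx; rewrite lt0n dimv_eq0; apply: contraNneq nzx => U0; rewrite -memv0 -U0.
Qed.

Lemma subv_coset (U W : {vspace M}) w : (U <= W)%VS -> (coset U w <= coset W w)%VS.
Proof. exact: prodvSl. Qed.

Lemma linfun_linE (uT vT : vectType k) (f : uT -> vT) : linear f -> linfun f =1 f.
Proof.
move=> lf; pose lfM := GRing.isLinear.Build _ _ _ _ f lf.
by pose F : {linear uT -> vT} := HB.pack f lfM; apply: (lfunE F).
Qed.

Variable s : {scalar M}.
Hypothesis s_neq0 : exists u, s u != 0.

Lemma sZ c x : s (c *: x) = c * s x.
Proof. exact: linearZ. Qed.

Lemma sD x y : s (x + y) = s x + s y.
Proof. exact: linearD. Qed.

Lemma s_sum I r (P : pred I) (E : I -> M) :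
  s (\sum_(i <- r | P i) E i) = \sum_(i <- r | P i) s (E i).
Proof. exact: linear_sum. Qed.

Lemma s_nondeg (x : M) : (forall y, s (x * y) = 0) -> x = 0.
Proof.
move=> sx0; apply: contraTeq isT => nzx.
by have [u /eqP[]] := s_neq0; rewrite -(sx0 (x^-1 * u)) mulVKf.
Qed.

(** By nondegeneracy of s(xy), an element orthogonal to Y is determined by its pairings with a
    complement of Y. *)
Lemma perp_dim (X Y : {vspace M}) :
  (forall x y, x \in X -> y \in Y -> s (x * y) = 0) ->
  (\dim X + \dim Y <= \dim {:M})%N.
Proof.
move=> XY0; pose B := vbasis Y^C.
pose f (x : M) : 'rV[k]_(\dim Y^C) := \row_j s (x * B`_j).
have flin : linear f.
  by move=> c u v; apply/rowP=> j; rewrite !mxE mulrDl -scalerAl linearP.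
suff : (\dim X <= \dim Y^C)%N.
  by rewrite dimv_compl; have := dimvS (subvf Y); lia.
suff <- : \dim (linfun f @: X) = \dim X.
  by have := dimvS (subvf (linfun f @: X)); rewrite dimvf dim_matrix; lia.
apply: limg_dim_eq; apply/eqP; rewrite -subv0; apply/subvP=> x.
rewrite memv_cap memv_ker linfun_linE // memv0 => /andP[Xx /eqP fx].
apply/eqP/s_nondeg => y.
have : y \in (Y + Y^C)%VS by rewrite addv_complf memvf.
case/memv_addP=> u Yu [v Yv ->]; rewrite mulrDr sD XY0 // add0r.
rewrite (coord_vbasis Yv) mulr_sumr s_sum big1 // => j _.
rewrite -scalerAr sZ.
by move/rowP/(_ j): fx; rewrite !mxE => ->; rewrite mulr0.
Qed.

Local Notation im T := (limg T%R).
Local Notation rk T := (\dim (limg T%R)).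

(** The form scaled by [iota a]: multiplication by a carries [im T] to the image of the conjugate
    and multiplies the values by [iota a]. *)
Definition conj (a : M) (T : 'End(M)) : 'End(M) :=
  (amull a \o T \o amull (a^-1)%R)%VF.

Lemma conjE a T x : conj a T x = a * T (a^-1 * x) :> M.
Proof. by rewrite /conj !comp_lfunE !lfunE. Qed.

Lemma conjD a T T' : conj a (T + T') = conj a T + conj a T'.
Proof. by apply/lfunP=> x; rewrite !(add_lfunE, conjE) mulrDr. Qed.

Lemma conj0 a : conj a 0 = 0.
Proof. by apply/lfunP=> x; rewrite conjE !zero_lfunE mulr0. Qed.

Lemma conjM a b T : conj a (conj b T) = conj (a * b) T.
Proof. by apply/lfunP=> x; rewrite !conjE invfM -!mulrA [b^-1 * (a^-1 * x)]mulrCA. Qed.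

Lemma conj1 T : conj 1 T = T.
Proof. by apply/lfunP=> x; rewrite conjE invr1 !mul1r. Qed.

Lemma addTT (T : 'End(M)) : T + T = 0.
Proof. by apply/lfunP=> x; rewrite add_lfunE zero_lfunE addMM. Qed.

Lemma addTK (T : 'End(M)) : involutive (fun T' : 'End(M) => T' + T).
Proof. by move=> T'; rewrite -addrA addTT addr0. Qed.

Lemma limg_conj a T : a != 0 -> im (conj a T) = coset (im T) a.
Proof.
move=> nza; apply/vspaceP=> x; rewrite mem_coset //; apply/idP/idP.
  by case/memv_imgP=> y _ ->; rewrite conjE mulrC mulKf // memv_img ?memvf.
case/memv_imgP=> y _ xE; apply/memv_imgP; exists (a * y); rewrite ?memvf //.
by rewrite conjE mulKf // -xE mulrC divfK.
Qed.

Lemma rk_conj a T : a != 0 -> rk (conj a T) = rk T.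
Proof. by move=> nza; rewrite limg_conj // dim_coset. Qed.

Lemma limgT_mem (T : 'End(M)) x : T x \in im T.
Proof. by rewrite memv_img ?memvf. Qed.

Lemma limgD_sub (T T' : 'End(M)) : (im (T + T') <= im T + im T')%VS.
Proof.
apply/subvP=> _ /memv_imgP[x _ ->]; rewrite add_lfunE.
by rewrite memv_add ?limgT_mem.
Qed.

Lemma limg_eq0 (T : 'End(M)) : (im T == 0%VS) = (T == 0).
Proof.
apply/eqP/eqP=> [T0 | ->]; last exact: lim0g.
apply/lfunP=> x; rewrite zero_lfunE; apply/eqP.
by rewrite -memv0 -T0 limgT_mem.
Qed.

(** * Anisotropic forms as operators *)

(* T encodes the anisotropic bilinear form (T x, T y) |-> s (x * T y) on the
   subspace im T of M. *)
Definition normal_form (T : 'End(M)) : Prop :=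
  (forall x y, s (x * T y) = s (T x * y)) /\
  (forall x, s (x * T x) = iota (T x)).

Lemma normal0 : normal_form 0.
Proof. by split=> [x y|x]; rewrite !zero_lfunE ?mulr0 ?mul0r ?raddf0. Qed.

Lemma normalD T T' : normal_form T -> normal_form T' -> normal_form (T + T').
Proof.
move=> [sT qT] [sT' qT']; split=> [x y|x]; rewrite !add_lfunE.
  by rewrite mulrDr mulrDl !sD sT sT'.
by rewrite mulrDr sD raddfD /= qT qT'.
Qed.

Lemma iota_mulmul a (x y : M) : (a * x) * (a * y) = iota a *: (x * y).
Proof. by rewrite mulrACA iotaP mulr_algl. Qed.

Lemma normal_conj a T : normal_form T -> normal_form (conj a T).
Proof.
have [-> _ | nza] := eqVneq a 0.
  suff -> : conj 0 T = 0 by apply: normal0.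
  by apply/lfunP=> x; rewrite conjE mul0r zero_lfunE.
move=> [sT qT]; split=> [x y|x]; rewrite !conjE.
  rewrite -{1}[x](mulVKf nza) -{2}[y](mulVKf nza) !iota_mulmul !sZ.
  by rewrite sT.
by rewrite -{1}[x](mulVKf nza) iota_mulmul sZ qT rmorphM.
Qed.

(** For H the inverse of a Gram matrix this is the composite of x |-> s(x b_i), the isomorphism from
    the dual space, and the map sending the i-th basis vector to b_i. The family b may be dependent,
    so isotropic forms have an operator too. *)
Definition pairing_op m (b : 'I_m -> M) (H : 'M[k]_m) : 'End(M) :=
  linfun (fun x => \sum_j ((\row_i s (x * b i)) *m H) 0 j *: b j).

Lemma pairing_opE m (b : 'I_m -> M) H x :
  pairing_op b H x = \sum_j ((\row_i s (x * b i)) *m H) 0 j *: b j.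
Proof.
rewrite /pairing_op linfun_linE // => c u v.
rewrite scaler_sumr -big_split /=; apply: eq_bigr => j _.
rewrite scalerA -scalerDl; congr (_ *: _).
have -> : \row_i s ((c *: u + v) * b i) =
    c *: \row_i s (u * b i) + \row_i s (v * b i).
  by apply/rowP=> i; rewrite !mxE mulrDl -scalerAl linearP.
by rewrite mulmxDl -scalemxAl !mxE.
Qed.

Lemma s_pairing_op m (b : 'I_m -> M) H x y :
  s (x * pairing_op b H y) =
  ((\row_i s (y * b i)) *m H *m (\row_i s (x * b i))^T) 0 0.
Proof.
rewrite pairing_opE mulr_sumr s_sum [RHS]mxE; apply: eq_bigr => j _.
by rewrite -scalerAr sZ !mxE.
Qed.

Lemma pair_sum_sym m (f : 'I_m -> 'I_m -> k) : (forall i j, f i j = f j i) ->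
  \sum_i \sum_j f i j = \sum_i f i i.
Proof.
move=> fC.
have E : \sum_i \sum_j f i j = \sum_i f i i +
   (\sum_(i < m) \sum_(j < m | (j < i)%N) f i j +
    \sum_(i < m) \sum_(j < m | (i < j)%N) f i j).
  rewrite -!big_split /=; apply: eq_bigr => i _.
  rewrite (bigD1 i) //=; congr (_ + _).
  rewrite (bigID (fun j : 'I_m => (j < i)%N)) /=; congr (_ + _).
    by apply: eq_bigl => j; rewrite -val_eqE /=; lia.
  by apply: eq_bigl => j; rewrite -val_eqE /=; lia.
suff X : \sum_(i < m) \sum_(j < m | (i < j)%N) f i j =
    \sum_(i < m) \sum_(j < m | (j < i)%N) f i j by rewrite E X addkk addr0.
rewrite (exchange_big_dep xpredT) //=.
by apply: eq_bigr => i _; apply: eq_bigr => j _; rewrite fC.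
Qed.

Lemma sym_quad m (G : 'M[k]_m) (z : 'rV_m) : G^T = G ->
  (z *m G *m z^T) 0 0 = \sum_j z 0 j ^+ 2 * G j j.
Proof.
move=> symG; rewrite mxE.
under eq_bigr => j _ do rewrite mxE mulr_suml.
rewrite pair_sum_sym => [|i j].
  by apply: eq_bigr => j _; rewrite !mxE expr2; ring.
by rewrite -{1}symG !mxE; ring.
Qed.

(** With z the coordinate row of T x, s(x T x) equals z G z^T; off-diagonal terms cancel in pairs,
    and the remaining sum of z_j^2 G_jj is iota of the sum of the z_j b_j. *)
Lemma normal_pairing m (b : 'I_m -> M) (G : 'M[k]_m) :
  G^T = G -> G \in unitmx -> (forall i, G i i = iota (b i)) ->
  normal_form (pairing_op b (invmx G)).
Proof.
move=> symG uG Gb.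
have symH : (invmx G)^T = invmx G by rewrite trmx_inv symG.
split=> [x y|x].
  rewrite [in RHS]mulrC !s_pairing_op; set u := \row_i _; set v := \row_i _.
  by rewrite -[LHS]trace_mx11 -mxtrace_tr !trmx_mul trmxK symH mulmxA trace_mx11.
rewrite s_pairing_op pairing_opE raddf_sum; set y := \row_i _.
have -> : y *m invmx G *m y^T = (y *m invmx G) *m G *m (y *m invmx G)^T.
  by rewrite trmx_mul symH !mulmxA mulmxKV.
by rewrite sym_quad //; apply: eq_bigr => j _; rewrite /= iotaZ Gb.
Qed.

(** The pseudo-inverse picks one preimage of p. For T symmetric and q in [im T] the choice is
    immaterial, since ker T is orthogonal to im T. *)
Definition beta (T : 'End(M)) (p q : M) : k := s ((T^-1)%VF p * q).

Lemma betaDl T p p' q : beta T (p + p') q = beta T p q + beta T p' q.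
Proof. by rewrite /beta linearD mulrDl sD. Qed.

Lemma betaZl T c p q : beta T (c *: p) q = c * beta T p q.
Proof. by rewrite /beta linearZ -scalerAl sZ. Qed.

Lemma betaDr T p q q' : beta T p (q + q') = beta T p q + beta T p q'.
Proof. by rewrite /beta mulrDr sD. Qed.

Lemma betaZr T c p q : beta T p (c *: q) = c * beta T p q.
Proof. by rewrite /beta -scalerAr sZ. Qed.

Lemma beta_sumr T p I r (P : pred I) (E : I -> M) :
  beta T p (\sum_(i <- r | P i) E i) = \sum_(i <- r | P i) beta T p (E i).
Proof. by rewrite /beta mulr_sumr s_sum. Qed.

Section Forms.

Implicit Types (T R : 'End(M)) (P : {vspace M}) (a b p q u v w x y z : M).

Lemma betaE T x q : normal_form T -> q \in im T -> beta T (T x) q = s (x * q).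
Proof.
by move=> [sT _] /memv_imgP[y _ ->]; rewrite /beta !sT limg_lfunVK ?limgT_mem.
Qed.

Lemma betaC T p q : normal_form T -> p \in im T -> q \in im T ->
  beta T p q = beta T q p.
Proof.
move=> nT /memv_imgP[x _ ->] /memv_imgP[y _ ->].
by rewrite !betaE ?limgT_mem // [y * _]mulrC nT.1.
Qed.

Lemma beta_diag T p : normal_form T -> p \in im T -> beta T p p = iota p.
Proof. by move=> nT /memv_imgP[x _ ->]; rewrite betaE ?limgT_mem ?nT.2. Qed.

(** The difference d = T x - R x satisfies beta(d, d) = s(x d) - s(x d) = 0, and beta(d, d) = iota
    d, so d = 0. *)
Lemma normal_uniq T R : normal_form T -> normal_form R -> im T = im R ->
  {in im T &, forall p q, beta T p q = beta R p q} -> T = R.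
Proof.
move=> nT nR imE bE; apply/lfunP=> x; apply/eqP; rewrite -subr_eq0.
have TxR : R x \in im T by rewrite imE limgT_mem.
set d := T x - R x; have Td : d \in im T by rewrite memvB ?limgT_mem.
rewrite -iota_eq0 -(beta_diag nT Td) {1}/d -scaleN1r betaDl betaZl mulN1r.
by rewrite (betaE _ nT Td) (bE _ _ TxR Td) (betaE _ nR) -?imE // subrr.
Qed.

Definition sub_form R T : Prop :=
  [/\ normal_form R, (im R <= im T)%VS &
      {in im R &, forall p q, beta R p q = beta T p q}].

Lemma sub_form_refl T : normal_form T -> sub_form T T.
Proof. by []. Qed.

Lemma sub_form_uniq R R' T :
  sub_form R T -> sub_form R' T -> im R = im R' -> R = R'.
Proof.
move=> [nR _ bR] [nR' _ bR'] imE; apply: normal_uniq => // p q Rp Rq.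
by rewrite bR // bR' -?imE.
Qed.

(** Anisotropy makes the Gram matrix on any subspace invertible: a vector of its kernel would be
    isotropic. The restriction is then given by [pairing_op] on a basis. *)
Lemma sub_form_ex T P : normal_form T -> (P <= im T)%VS ->
  exists2 R, sub_form R T & im R = P.
Proof.
move=> nT /subvP sPT; pose b (i : 'I_(\dim P)) := (vbasis P)`_i.
have Pb i : b i \in P by rewrite vbasis_mem ?mem_nth ?size_tuple.
pose G := \matrix_(i, j) beta T (b i) (b j).
have symG : G^T = G.
  by apply/matrixP=> i j; rewrite !mxE betaC // sPT.
have uG : G \in unitmx.
  rewrite -row_free_unit; apply/inj_row_free => v vG0.
  pose p := \sum_i v 0 i *: b i.
  have Pp : p \in P by apply: memv_suml => i _; rewrite memvZ.
  have bbp j : beta T (b j) p = 0.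
    transitivity ((v *m G) 0 j); last by rewrite vG0 mxE.
    rewrite beta_sumr mxE; apply: eq_bigr => i _; rewrite betaZr mxE betaC // sPT //; exact: Pb.
  have bp q : q \in P -> beta T q p = 0.
    move=> Pq; rewrite betaC ?sPT // (coord_vbasis Pq) beta_sumr big1 // => j _.
    by rewrite betaZr betaC ?sPT ?bbp ?mulr0 //; apply: Pb.
  have /eqP := bp p Pp; rewrite beta_diag ?sPT // iota_eq0 => /eqP p0.
  apply/rowP=> i; rewrite mxE.
  by have /freeP/(_ (v 0) p0 i) := basis_free (vbasisP P).
have nR : normal_form (pairing_op b (invmx G)).
  by apply: normal_pairing => // i; rewrite mxE beta_diag ?sPT.
have imRP x : pairing_op b (invmx G) x \in P.
  by rewrite pairing_opE; apply: memv_suml => j _; rewrite memvZ.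
have bR x q : q \in P -> beta T (pairing_op b (invmx G) x) q = s (x * q).
  move=> Pq; rewrite (coord_vbasis Pq) beta_sumr mulr_sumr s_sum.
  apply: eq_bigr => j _; rewrite betaZr -scalerAr sZ; congr (_ * _).
  rewrite betaC ?sPT //; last exact: Pb.
  rewrite pairing_opE beta_sumr; set y := \row_i _.
  have -> : s (x * (vbasis P)`_j) = y 0 j by rewrite mxE.
  rewrite -[y in RHS](mulmxKV uG) [RHS]mxE; apply: eq_bigr => i _.
  rewrite betaZr mxE; congr (_ * _).
  by rewrite mxE; apply: betaC => //; apply: sPT; apply: Pb.
have imR : im (pairing_op b (invmx G)) = P.
  apply/vspaceP=> p; apply/idP/idP => [/memv_imgP[x _ ->] // | Pp].
  have /memv_imgP[z _ pE] := sPT p Pp.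
  suff -> : p = pairing_op b (invmx G) z by rewrite limgT_mem.
  apply/eqP; rewrite -subr_eq0; set d := _ - _.
  have Pd : d \in P by rewrite memvB.
  rewrite -iota_eq0 -(beta_diag nT (sPT _ Pd)) {1}/d -scaleN1r betaDl betaZl bR //.
  by rewrite mulN1r pE betaE ?subrr ?sPT.
exists (pairing_op b (invmx G)) => //; split=> //.
  by rewrite imR; apply/subvP.
move=> p q /memv_imgP[x _ ->] Rq; rewrite betaE // bR //.
by rewrite -imR.
Qed.

(* In characteristic 2 the complement of a subform is the sum T + R. *)
Lemma sub_form_compl R T : normal_form T -> sub_form R T ->
  [/\ sub_form (T + R) T,
      (\dim (im (T + R)) + \dim (im R))%N = \dim (im T),
      {in im (T + R) & im R, forall p q, beta T p q = 0} &
      forall p, p \in im T -> {in im R, forall q, beta T p q = 0} ->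
        p \in im (T + R)].
Proof.
move=> nT sRT; have [nR sR bR] := sRT; have /subvP sR' := sR.
have sTR : (im (T + R) <= im T)%VS.
  apply: subv_trans (limgD_sub _ _) _; by rewrite subv_add subvv.
have orth : {in im (T + R) & im R, forall p q, beta T p q = 0}.
  move=> _ q /memv_imgP[x _ ->] Rq; rewrite add_lfunE betaDl.
  by rewrite (betaE _ nT (sR' _ Rq)) -(bR _ _ (limgT_mem R x) Rq) (betaE _ nR Rq) addkk.
have cap0 : (im (T + R) :&: im R = 0)%VS.
  apply/eqP; rewrite -subv0; apply/subvP=> p; rewrite memv_cap memv0.
  case/andP=> TRp Rp; rewrite -iota_eq0 -(beta_diag nT) ?orth ?eqxx //.
  exact: sR'.
have sumE : (im (T + R) + im R)%VS = im T.
  apply: subv_anti; rewrite subv_add sTR sR /=.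
  have {1}-> : T = (T + R) + R by rewrite -addrA addTT addr0.
  exact: limgD_sub.
split=> //.
- split=> //; first exact: normalD.
  move=> _ q /memv_imgP[x _ ->] TRq; have Tq := subvP sTR _ TRq.
  rewrite (betaE _ (normalD nT nR) TRq) add_lfunE betaDl (betaE _ nT Tq).
  have Rx := limgT_mem R x; by rewrite (betaC nT (sR' _ Rx) Tq) orth ?addr0.
- by rewrite -sumE dimv_disjoint_sum.
move=> p; rewrite -sumE => /memv_addP[u TRu [v Rv ->]] orthp.
suff /eqP-> : v == 0 by rewrite addr0.
have := orthp v Rv; rewrite betaDl orth // add0r beta_diag ?sR' //.
by move/eqP; rewrite iota_eq0.
Qed.

(** The common restriction R to P cancels: T + T' is the sum of the two complements T + R and T' +
    R. *)
Lemma common_sub_form P T T' : normal_form T -> normal_form T' ->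
  (P <= im T)%VS -> (P <= im T')%VS ->
  {in P &, forall p q, beta T p q = beta T' p q} ->
  (rk (T + T') + 2 * \dim P <= rk T + rk T')%N.
Proof.
move=> nT nT' sPT sPT' bE.
have [R [nR sR bR] RP] := sub_form_ex nT sPT.
have sRT' : sub_form R T'.
  by split; rewrite ?RP // => p q Pp Pq; rewrite bR ?RP // bE.
have [_ d1 _ _] := sub_form_compl nT (And3 nR sR bR).
have [_ d2 _ _] := sub_form_compl nT' sRT'.
have -> : T + T' = (T + R) + (T' + R) by rewrite addrACA addTT addr0.
have := dimvS (limgD_sub (T + R) (T' + R)).
have := dimv_sum_cap (im (T + R)) (im (T' + R)).
rewrite RP in d1 d2; lia.
Qed.

(** The one-dimensional form with value [iota b]. *)
Definition rank1 (b : M) : 'End(M) := linfun (fun x => (s (x * b) / iota b) *: b).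

Lemma rank1E b x : rank1 b x = (s (x * b) / iota b) *: b.
Proof.
rewrite /rank1 linfun_linE // => c u v.
by rewrite mulrDl -scalerAl sD sZ scalerA -scalerDl mulrDl mulrA.
Qed.

Lemma normal_rank1 b : normal_form (rank1 b).
Proof.
split=> [x y|x]; rewrite !rank1E.
  by rewrite -scalerAr -scalerAl !sZ [b * y]mulrC; ring.
rewrite -scalerAr sZ iotaZ; have [-> | nz] := eqVneq b 0.
  by rewrite rmorph0 invr0 mulr0 !mul0r expr0n /= mul0r.
by field; rewrite iota_eq0.
Qed.

Lemma im_rank1 b : b != 0 -> im (rank1 b) = <[b]>%VS.
Proof.
move=> nz; apply/vspaceP=> x; apply/idP/idP.
  by case/memv_imgP=> y _ ->; rewrite rank1E memvZ ?memv_line.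
case/vlineP=> c ->; rewrite memvZ //.
have [u su] := s_neq0.
have nzc : s u / iota b != 0 by rewrite mulf_neq0 ?invr_eq0 ?iota_eq0.
have := memvZ (s u / iota b)^-1 (limgT_mem (rank1 b) (u / b)).
by rewrite rank1E divfK // scalerK.
Qed.

Lemma conj_rank1 a b : conj a (rank1 b) = rank1 (a * b).
Proof.
apply/lfunP=> x; rewrite conjE !rank1E -scalerAr; congr (_ *: _).
rewrite rmorphM /= invM -scalerAl -scalerAl sZ invfM.
by rewrite [x * (a * b)]mulrCA mulrA; ring.
Qed.

Lemma comm_op_linear T : linear (fun a => (amull a \o T)%VF - (T \o amull a)%VF).
Proof.
move=> c u v; apply/lfunP=> x.
rewrite !(add_lfunE, opp_lfunE, scale_lfunE, comp_lfunE) !lfunE /=.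
by rewrite !mulrDl -!scalerAl linearD linearZ /= scalerBr opprD addrACA.
Qed.

(** * Similarities and powers of the fundamental ideal *)

Definition cent_vs T : {vspace M} :=
  lker (linfun (fun a => (amull a \o T)%VF - (T \o amull a)%VF)).

Lemma cent_vsP T a : a \in cent_vs T <-> forall x, T (a * x) = a * T x :> M.
Proof.
rewrite memv_ker linfun_linE; last exact: comm_op_linear.
split=> [/eqP/lfunP Ta x | Ta].
  have := Ta x; rewrite add_lfunE opp_lfunE !comp_lfunE !lfunE /=.
  by move/eqP; rewrite subr_eq0 => /eqP.
apply/eqP/lfunP=> x; rewrite add_lfunE opp_lfunE !comp_lfunE !lfunE /= Ta.
by rewrite subrr.
Qed.

Lemma cent_is_aspace T : is_aspace (cent_vs T).
Proof.
rewrite /is_aspace has_algid1 /=; last by apply/cent_vsP=> x; rewrite !mul1r.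
apply/prodvP=> u v /cent_vsP Tu /cent_vsP Tv; apply/cent_vsP=> x.
by rewrite -!mulrA Tu Tv.
Qed.

(** The nonzero elements give similarity factors, as conjugation by them fixes T; moreover [im T] is
    a vector space over this field. *)
Definition cent T : {subfield M} := ASpace (cent_is_aspace T).

Arguments cent T%_R.

Lemma centP T a : a \in cent T <-> forall x, T (a * x) = a * T x :> M.
Proof. exact: cent_vsP. Qed.

Lemma cent_im T a x : a \in cent T -> x \in im T -> a * x \in im T.
Proof.
by move=> /centP Ta /memv_imgP[y _ ->]; rewrite -Ta limgT_mem.
Qed.

Lemma cent_beta T a p q : normal_form T -> a \in cent T ->
  p \in im T -> q \in im T -> beta T (a * p) q = beta T p (a * q).
Proof.
move=> nT Ta /memv_imgP[x _ ->] Tq; have /centP <- := Ta.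
by rewrite !betaE ?cent_im // mulrCA mulrA.
Qed.

Lemma conj_cent T a : a != 0 -> a \in cent T -> conj a T = T.
Proof.
by move=> nza /centP Ta; apply/lfunP=> x; rewrite conjE -Ta mulVKf.
Qed.

Lemma step_eq0 T a : a != 0 -> (T + conj a T == 0) = (a \in cent T).
Proof.
move=> nza; apply/idP/idP=> [/eqP T0 | Ta]; last by rewrite conj_cent ?addTT.
apply/centP=> x; have /lfunP/(_ (a * x)) := T0.
rewrite add_lfunE conjE mulKf // zero_lfunE => /eqP.
by rewrite addr_eq0 oppM => /eqP.
Qed.

Lemma centD T T' a : a \in cent T -> a \in cent T' -> a \in cent (T + T').
Proof.
move=> /centP Ta /centP T'a; apply/centP=> x.
by rewrite !add_lfunE Ta T'a mulrDr.
Qed.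

Lemma cent_conj T a b : a != 0 -> (b \in cent (conj a T)) = (b \in cent T).
Proof.
move=> nza; apply/idP/idP=> /centP Tb; apply/centP=> x.
  have := Tb (a * x); rewrite !conjE !mulKf // mulrCA !mulKf // mulrCA.
  exact: mulfI.
by rewrite !conjE mulrCA Tb mulrCA.
Qed.

(** Since a^2 is a scalar, conjugation by a is an involution exchanging the two summands. *)
Lemma cent_step T a : a != 0 -> a \in cent (T + conj a T).
Proof.
move=> nza; apply/centP=> x; rewrite !add_lfunE !conjE mulKf //.
rewrite mulrDr addrC; congr (_ + _).
have -> : a * x = iota a *: (a^-1 * x).
  by rewrite invM scalerAl scalerA mulfV ?scale1r // iota_eq0.
by rewrite linearZ /= mulrA iotaP mulr_algl.
Qed.

Lemma cent_stepS T a b : a != 0 -> b \in cent T -> b \in cent (T + conj a T).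
Proof. by move=> nza Tb; apply: centD => //; rewrite cent_conj. Qed.

(** The defect d = R(a x) - a R(x) lies in [im R] and is isotropic, hence 0. *)
Lemma cent_sub_form R T a : normal_form T -> sub_form R T -> a \in cent T ->
  (forall x, x \in im R -> a * x \in im R) -> a \in cent R.
Proof.
move=> nT [nR /subvP sR bR] Ta aR; apply/centP=> x.
apply/eqP; rewrite -subr_eq0; set d := _ - _.
have Rd : d \in im R by rewrite memvB ?aR ?limgT_mem.
rewrite -iota_eq0 -(beta_diag nR Rd) {1}/d -scaleN1r betaDl betaZl mulN1r.
rewrite betaE // (bR _ _ (aR _ (limgT_mem R x)) Rd) (cent_beta nT Ta) ?sR ?limgT_mem //.
by rewrite -bR ?aR ?limgT_mem // betaE ?aR // mulrCA mulrA subrr.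
Qed.

Lemma sub_form_conj R T a : a != 0 -> normal_form T -> sub_form R T ->
  sub_form (conj a R) (conj a T).
Proof.
move=> nza nT [nR sR bR]; split; first exact: normal_conj.
  by rewrite !limg_conj // subv_coset.
have beta_conj T' p q : normal_form T' -> p \in im T' -> q \in im T' ->
    beta (conj a T') (a * p) (a * q) = iota a * beta T' p q.
  move=> nT' /memv_imgP[x _ ->] T'q.
  have -> : a * T' x = conj a T' (a * x) by rewrite conjE mulKf.
  rewrite !betaE ?iota_mulmul ?sZ //; first exact: normal_conj.
  by rewrite limg_conj // mem_coset // mulrC mulKf.
move=> p q; rewrite !limg_conj // !mem_coset // => Rp Rq.
rewrite -[p](divfK nza) -[q](divfK nza) ![_ / a * a]mulrC !beta_conj ?bR //.
  exact: (subvP sR).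
exact: (subvP sR).
Qed.

Inductive Ipow : nat -> 'End(M) -> Prop :=
  | Ipow_zero n : Ipow n 0
  | Ipow_add n T T' : Ipow n T -> Ipow n T' -> Ipow n (T + T')
  | Ipow_rank1 b : b != 0 -> Ipow 0 (rank1 b)
  | Ipow_step n T a : a != 0 -> Ipow n T -> Ipow n.+1 (T + conj a T).

Lemma Ipow_normal n T : Ipow n T -> normal_form T.
Proof.
elim=> {n T} [n|n T T' _ nT _|b _|n T a _ _ nT].
- exact: normal0.
- exact: normalD.
- exact: normal_rank1.
- by apply: normalD => //; apply: normal_conj.
Qed.

Lemma Ipow_conj n T b : b != 0 -> Ipow n T -> Ipow n (conj b T).
Proof.
move=> nzb; elim=> {n T} [n|n T T' _ IT _ IT'|c nzc|n T a nza _ IT].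
- by rewrite conj0; apply: Ipow_zero.
- by rewrite conjD; apply: Ipow_add.
- by rewrite conj_rank1; apply: Ipow_rank1; rewrite mulf_neq0.
- by rewrite conjD conjM mulrC -conjM; apply: Ipow_step.
Qed.

(* Operators in I^n are sums of operators commuting with a field of degree 2^n,
   hence vanish when no such field fits in M. *)
Inductive cent_sum n : 'End(M) -> Prop :=
  | cent_sum0 : cent_sum n 0
  | cent_sumD T T' : cent_sum n T -> cent_sum n T' -> cent_sum n (T + T')
  | cent_sum1 T : (2 ^ n <= \dim (cent T))%N -> cent_sum n T.

(** For each summand, either a already commutes and the new term cancels, or adjoining a doubles the
    commuting field. *)
Lemma cent_sum_step n T a : a != 0 -> cent_sum n T -> cent_sum n.+1 (T + conj a T).
Proof.
move=> nza; elim=> [|T1 T2 _ IT1 _ IT2|T1 le_n].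
- by rewrite conj0 addr0; apply: cent_sum0.
- by rewrite conjD addrACA; apply: cent_sumD.
have [Ta | nTa] := boolP (a \in cent T1).
  by rewrite conj_cent // addTT; apply: cent_sum0.
apply: cent_sum1; have d2 := dim_Fadjoin2 nTa.
have /dimvS le_d : (<<cent T1; a>> <= cent (T1 + conj a T1))%VS.
  apply/FadjoinP; split; last exact: cent_step.
  by apply/subvP=> b Tb; apply: cent_stepS.
by rewrite expnS; apply: leq_trans le_d; rewrite d2 leq_mul2l.
Qed.

Lemma Ipow_eq0 n T : Ipow n T -> (\dim {:M} < 2 ^ n)%N -> T = 0.
Proof.
move=> IT lt_n; have : cent_sum n T.
  elim: IT => {n T lt_n} [n|n T T' _ IT _|b _|n T a nza _].
  - exact: cent_sum0.
  - exact: cent_sumD.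
  - by apply: cent_sum1; rewrite expn0 adim_gt0.
  - exact: cent_sum_step.
elim=> {T IT} [//|T T' _ -> _ ->|T le_n]; first by rewrite addr0.
by move: lt_n; rewrite ltnNge (leq_trans le_n) ?dimvS ?subvf.
Qed.

Lemma rk_step T a : (rk (T + conj a T) <= \dim (im T + coset (im T) a))%N.
Proof.
have [-> | nza] := eqVneq a 0.
  have -> : conj 0 T = 0 by apply/lfunP=> x; rewrite conjE mul0r zero_lfunE.
  by rewrite addr0 dimvS ?addvSl.
by apply: dimvS; apply: subv_trans (limgD_sub _ _) _; rewrite limg_conj.
Qed.

Lemma rk_step_ratio T v w : v \in im T -> w \in im T -> v != 0 -> w != 0 ->
  (rk (T + conj (v / w) T) < 2 * rk T)%N.
Proof.
move=> Tv Tw nzv nzw; have nza : v / w != 0 by rewrite mulf_neq0 ?invr_eq0.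
apply: leq_ltn_trans (rk_step _ _) _.
have := dimv_sum_cap (im T) (coset (im T) (v / w)); rewrite dim_coset //.
suff /dim_gt0/(_ nzv) : v \in (im T :&: coset (im T) (v / w))%VS by clear; lia.
by rewrite memv_cap Tv mem_coset // invfM invrK mulrA mulfV ?mul1r.
Qed.

Lemma im_cent T w : w \in im T -> w != 0 ->
  (forall v, v \in im T -> v / w \in cent T) -> im T = coset (cent T) w.
Proof.
move=> Tw nzw ratio; apply/vspaceP=> x; rewrite mem_coset //.
by apply/idP/idP=> [/ratio // | Tx]; rewrite -[x](divfK nzw) cent_im.
Qed.

(** The Arason-Pfister Hauptsatz with its equality case, by downward induction on n. If some ratio
    v/w does not commute with T, multiplying by it yields a nonzero element of I^(n+1) of rank
    strictly below 2 rk T, so rk T > 2^n. Otherwise [im T] is a line over [cent T], and any y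
    outside [cent T] gives 2^(n+1) <= 2 rk T. *)
Lemma Ipow_hauptsatz n T w : Ipow n T -> w \in im T -> w != 0 ->
  (2 ^ n <= rk T)%N /\ (rk T = (2 ^ n)%N -> im T = coset (cent T) w).
Proof.
have [m le_m] : exists m, (\dim {:M} < 2 ^ (n + m))%N.
  exists (\dim {:M}); rewrite expnD.
  by apply: leq_trans (ltn_expl _ (ltnSn 1)) _; rewrite leq_pmull ?expn_gt0.
elim: m => [|m IHm] in n T w le_m *; move=> IT Tw nzw.
  have T0 : T = 0 by apply: (Ipow_eq0 IT); rewrite -[n]addn0.
  by move: Tw nzw; rewrite T0 lim0g memv0 => ->.
have step (a : M) : a != 0 -> a \notin cent T -> (2 ^ n.+1 <= rk (T + conj a T))%N.
  move=> nza nTa; set T1 := T + conj a T.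
  have nz1 : im T1 != 0%VS by rewrite limg_eq0 step_eq0.
  have [] := IHm n.+1 T1 (vpick (im T1)); rewrite ?addSnnS ?memv_pick ?vpick0 //.
  exact: Ipow_step.
have [ratio | nratio] :=
  classic (forall v, v \in im T -> v / w \in cent T); last first.
  have [v nv] := not_all_ex_not _ _ nratio.
  have [Tv /negP nTa] := imply_to_and _ _ nv.
  have nzv : v != 0 by apply: contraNneq nTa => ->; rewrite mul0r mem0v.
  have := step (v / w); rewrite mulf_neq0 ?invr_eq0 // => /(_ isT nTa).
  by have := rk_step_ratio Tv Tw nzv nzw; rewrite expnS; split; lia.
have imE := im_cent Tw nzw ratio; split=> //.
rewrite imE dim_coset //.
have [sM | /subvPn[y _ nTy]] := boolP (fullv <= cent T)%VS.
  rewrite leqNgt; apply: contra nzw => lt_n.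
  have T0 : T = 0.
    by apply: (Ipow_eq0 IT); apply: leq_ltn_trans lt_n; apply: dimvS.
  by move: Tw; rewrite T0 lim0g memv0.
have nzy : y != 0 by apply: contraNneq nTy => ->; rewrite mem0v.
have := step y nzy nTy; have := rk_step T y.
have := dimv_sum_cap (im T) (coset (im T) y); rewrite !dim_coset // imE.
by rewrite !dim_coset // expnS; lia.
Qed.

Lemma ann_space (f : M -> k) (X Y : {vspace M}) :
  (forall c u v, f (c *: u + v) = c * f u + f v) ->
  exists U : {vspace M},
    (forall x, x \in U <-> x \in X /\ forall y, y \in Y -> f (x * y) = 0) /\
    (\dim X <= \dim U + \dim Y)%N.
Proof.
move=> flin; pose g (x : M) : 'rV[k]_(\dim Y) := \row_j f (x * (vbasis Y)`_j).
have glin : linear g.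
  by move=> c u v; apply/rowP=> j; rewrite !mxE mulrDl -scalerAl flin.
have f0 : f 0 = 0 by have := flin 1 0 0; rewrite scaler0 addr0 mul1r -{1}[f 0]addr0 => /addrI.
exists (X :&: lker (linfun g))%VS; split=> [x|].
  rewrite memv_cap memv_ker linfun_linE //; split.
    case/andP=> Xx /eqP/rowP gx; split=> // y Yy; rewrite (coord_vbasis Yy) mulr_sumr.
    elim/big_rec: _ => // j z _ IHz; rewrite -scalerAr flin IHz.
    by have := gx j; rewrite !mxE => ->; rewrite mulr0 addr0.
  case=> Xx fx; rewrite Xx; apply/eqP/rowP=> j; rewrite !mxE fx //.
  by rewrite vbasis_mem ?mem_nth ?size_tuple.
have := limg_ker_dim (linfun g) X; have := dimvS (subvf (linfun g @: X)).
by rewrite dimvf dim_matrix; lia.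
Qed.

Definition pfister_op (xs : seq M) (T : 'End(M)) : 'End(M) :=
  foldr (fun x T' => T' + conj x T') T xs.

Lemma pfister_opD xs T T' : pfister_op xs (T + T') = pfister_op xs T + pfister_op xs T'.
Proof. by elim: xs => //= x xs ->; rewrite conjD addrACA. Qed.

Lemma pfister_op_conj xs a T : conj a (pfister_op xs T) = pfister_op xs (conj a T).
Proof. by elim: xs => //= x xs IH; rewrite conjD -IH !conjM mulrC. Qed.

Lemma Ipow_pfister n xs T : all (fun x => x != 0) xs -> Ipow n T ->
  Ipow (size xs + n) (pfister_op xs T).
Proof. by move=> + IT; elim: xs => //= x xs IH /andP[nzx /IH]; apply: Ipow_step. Qed.

Lemma coset_stable (E : {subfield M}) (w a x : M) : w != 0 -> a \in E ->
  x \in coset E w -> a * x \in coset E w.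
Proof. by move=> nzw Ea; rewrite !mem_coset // -mulrA => /(memv_mul Ea); rewrite prodv_id. Qed.

Lemma coset_self (E : {subfield M}) w : w \in coset E w.
Proof.
have [-> | nzw] := eqVneq w 0; first exact: mem0v.
by rewrite mem_coset // mulfV ?mem1v.
Qed.

(** One slot is split off for each quadratic step. Over a subfield Z' of index 2, counting
    dimensions gives a nonzero x in Z with beta(w, w x y) = 0 for all y in Z'. As Z consists of
    similarities, x Z' w is the orthogonal complement of Z' w, so T = R' + conj x R' is <<x>> times
    its restriction R' to Z' w. *)
Lemma field_form_pfister m T R (Z Y : {subfield M}) w :
    normal_form T -> {subset Z <= cent T} -> w != 0 -> im T = coset Z w ->
    (Y <= Z)%VS -> sub_form R T -> im R = coset Y w ->
    \dim Z = (2 ^ m * \dim Y)%N ->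
  exists xs, [/\ all (fun x => x != 0) xs, size xs = m & T = pfister_op xs R].
Proof.
elim: m => [|m IHm] in T Z *; move=> nT ZT nzw imT sYZ sRT imR dimZ.
  exists [::]; split=> //=; apply: (sub_form_uniq (sub_form_refl nT) sRT).
  rewrite imT imR; congr (coset _ w); apply/eqP.
  by rewrite eq_sym eqEdim sYZ dimZ expn0 mul1n leqnn.
have [m' [dimZ' chain]] := subfield_tower sYZ.
have le_m : (m <= m')%N.
  have d0 : (0 < \dim Y)%N by apply: adim_gt0.
  have : (2 ^ m <= 2 ^ m')%N; last by rewrite leq_exp2l.
  by rewrite -(leq_pmul2r d0) -dimZ' dimZ leq_pmul2r // leq_exp2l.
have [Z' [sYZ' sZ'Z dZ']] := chain m le_m.
pose f x := beta T w (w * x).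
have flin c u v : f (c *: u + v) = c * f u + f v.
  by rewrite /f mulrDr -scalerAr betaDr betaZr.
have [U [UP dimU]] := ann_space Z Z' flin.
have Z0 : (0 < \dim Z')%N by apply: adim_gt0.
have dZZ' : \dim Z = (2 * \dim Z')%N by rewrite dimZ dZ' mulnA expnS.
have nzU : U != 0%VS by rewrite -dimv_eq0; dlia.
pose x := vpick U; have nzx : x != 0 by rewrite vpick0.
have /UP[Zx fx] := memv_pick U; rewrite -/x in Zx fx.
have TZw z : z \in Z -> w * z \in im T by move=> Zz; rewrite imT mem_coset // mulrC mulKf.
have Tw : w \in im T by rewrite imT coset_self.
have sZ' := subvP sZ'Z.
have [R' sR'T imR'] : exists2 R', sub_form R' T & im R' = coset Z' w.
  by apply: sub_form_ex => //; rewrite imT; apply: subv_coset.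
have [nR' sR' bR'] := sR'T.
have [subC dimC _ orthC] := sub_form_compl nT sR'T.
have cR' a : a \in Z' -> a \in cent R'.
  move=> Za; apply: (cent_sub_form nT sR'T); first by apply/ZT/sZ'.
  by move=> y; rewrite imR'; apply: coset_stable.
have subX : sub_form (conj x R') T.
  by have := sub_form_conj nzx nT sR'T; rewrite (conj_cent nzx (ZT _ Zx)).
have imX : im (T + R') = im (conj x R').
  apply/esym/eqP; rewrite eqEdim rk_conj // limg_conj //; apply/andP; split.
    apply/subvP=> p; rewrite mem_coset // imR' mem_coset // => Z'p.
    have pE : p = w * (x * (p / x / w)).
      by rewrite mulrCA [w * _]mulrC divfK // mulrC divfK.
    rewrite pE; set z := p / x / w in Z'p *.
    apply: orthC; first exact: TZw (subfieldM Zx (sZ' _ Z'p)).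
    move=> q; rewrite imR' mem_coset // => Z'q.
    have -> : q = w * (q / w) by rewrite mulrC divfK.
    rewrite mulrC (cent_beta nT) ?TZw //; first last.
    - exact: sZ'.
    - exact: ZT _ (subfieldM Zx (sZ' _ Z'p)).
    rewrite mulrCA -mulrA -/(f _) fx //.
    exact: subfieldM.
  move: dimC dZZ'; rewrite imT imR' !dim_coset //; clear; dlia.
have TE : T = R' + conj x R'.
  by rewrite -(sub_form_uniq subC subX imX) addrC -addrA addTT addr0.
have sRR' : sub_form R R'.
  split; [by case: sRT | by rewrite imR imR' subv_coset |].
  have [_ _ bR] := sRT; have sR := subvP (subv_coset w sYZ').
  by move=> p q Rp Rq; rewrite bR // bR' // imR' sR // -imR.
have [xs [nzxs szxs R'E]] := IHm R' Z' nR' cR' nzw imR' sYZ' sRR' imR dZ'.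
by exists (x :: xs); split; rewrite /= ?nzx ?szxs -?R'E.
Qed.

Lemma sub_form_rank1 T w : normal_form T -> w \in im T -> w != 0 ->
  sub_form (rank1 w) T.
Proof.
move=> nT Tw nzw; split; first exact: normal_rank1.
  by rewrite im_rank1 // -memvE.
have Rw : w \in im (rank1 w) by rewrite im_rank1 ?memv_line.
move=> p q; rewrite im_rank1 // => /vlineP[c ->] /vlineP[d ->].
by rewrite !betaZl !betaZr !beta_diag //; apply: normal_rank1.
Qed.

Lemma Ipow_field n T (Z : {subfield M}) w :
  normal_form T -> {subset Z <= cent T} -> w != 0 -> im T = coset Z w ->
  \dim Z = (2 ^ n)%N -> Ipow n T.
Proof.
move=> nT ZT nzw imT dimZ.
have Tw : w \in im T by rewrite imT coset_self.
have imR : im (rank1 w) = coset 1%AS w by rewrite im_rank1 // /coset prod1v.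
have dZ : \dim Z = (2 ^ n * \dim (1%AS : {subfield M}))%N by rewrite dimv1 muln1.
have [xs [nzxs <- ->]] := field_form_pfister nT ZT nzw imT (sub1v Z)
  (sub_form_rank1 nT Tw nzw) imR dZ.
by have := Ipow_pfister nzxs (Ipow_rank1 nzw); rewrite addn0.
Qed.

Lemma normal_form_diag T : normal_form T ->
  exists ds : seq M, [/\ all (fun d : M => d != 0) ds, size ds = rk T &
    T = \sum_(d <- ds) rank1 d].
Proof.
have [m le_m] := ubnP (rk T); elim: m => // m IHm in T le_m *; move=> nT.
have [T0 | nzT] := eqVneq T 0.
  by exists [::]; rewrite T0 lim0g dimv0 big_nil.
pose v := vpick (im T); have nzv : v != 0 by rewrite vpick0 limg_eq0.
have Tv : v \in im T by apply: memv_pick.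
have sv := sub_form_rank1 nT Tv nzv.
have [[nT' _ _] dT _ _] := sub_form_compl nT sv.
have d1 : rk (rank1 v) = 1%N by rewrite im_rank1 // dim_vline nzv.
have [|ds [nzds szds TE]] := IHm (T + rank1 v) _ nT'.
  by move: dT le_m; rewrite d1; clear; dlia.
exists (v :: ds); split; rewrite /= ?nzv //.
  by rewrite szds -dT d1 addn1.
by rewrite big_cons -TE addrC -addrA addTT addr0.
Qed.

(** * Generic rank in linear pencils *)

Lemma free_size_dim (vT : vectType k) (X : seq vT) (U : {vspace vT}) :
  free X -> {subset X <= U} -> (size X <= \dim U)%N.
Proof.
by rewrite /free => /eqP <- /span_subvP; apply: dimvS.
Qed.

(** On preimages of a basis of the image of f, read in the coordinates of that basis, the pencil is
    c + N for a square matrix N; it is singular only at eigenvalues of -N. *)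
Lemma rank_pencil (uT vT : vectType k) (f g : 'Hom(uT, vT)) :
  exists2 p : {poly k}, p != 0 & forall c, p.[c] != 0 ->
    (\dim (limg f) <= \dim (limg (c *: f + g)%R))%N.
Proof.
pose e := vbasis (limg f); pose u (i : 'I_(\dim (limg f))) := (f^-1)%VF e`_i.
have fu i : f (u i) = e`_i by rewrite limg_lfunVK // vbasis_mem ?mem_nth ?size_tuple.
have free_e : free e := basis_free (vbasisP (limg f)).
pose N := \matrix_(i, j) coord e j (g (u i)).
exists (char_poly (- N)) => [|c pc]; first by rewrite monic_neq0 ?char_poly_monic.
pose X := [tuple (c *: f + g) (u i) | i < \dim (limg f)].
have <- : size X = \dim (limg f) by rewrite size_tuple.
apply: free_size_dim; last by move=> _ /mapP[i _ ->]; rewrite memv_img ?memvf.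
apply/freeP=> d dX0 i0; apply: contraNeq pc => di0.
suff : root (char_poly (- N)) c by [].
rewrite -eigenvalue_root_char; apply/eigenvalueP; exists (\row_i d i); last first.
  by apply: contraNneq di0 => /rowP/(_ i0); rewrite !mxE => ->.
apply/rowP=> j; apply/eqP; rewrite -subr_eq0 mulmxN !mxE -opprD oppr_eq0 addrC.
rewrite -[X in _ == X](linear0 (coord e j)) -dX0 linear_sum /=; apply/eqP.
under [RHS]eq_bigr => i _ do
  rewrite nth_mktuple add_lfunE scale_lfunE fu linearZ /= linearD linearZ /= mulrDr.
rewrite big_split /=; congr (_ + _); last by apply: eq_bigr => i _; rewrite !mxE.
rewrite (bigD1 j) //= big1 => [|i ne]; last first.
  by rewrite coord_free ?(negPf ne) ?mulr0 // free_e.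
by rewrite coord_free ?eqxx ?mulr1 ?addr0 ?[c * _]mulrC // free_e.
Qed.

(** * Maximal pairs and the rank gap *)

Hypothesis k_infinite : forall p : {poly k}, p != 0 -> exists c, p.[c] != 0.

(** The tangent condition at a point of maximal rank. Adding a column g x to f gives [F0]; if g x
    were new, [F0] would have larger rank, and so would a generic member of its pencil, whose image
    lies in that of c f + g because (c f + g)(x) = g x. *)
Lemma pencil_tangent (uT vT : vectType k) (f g : 'Hom(uT, vT)) (x : uT) :
  (forall c, \dim (limg (c *: f + g)%R) <= \dim (limg f))%N ->
  f x = 0 -> g x \in limg f.
Proof.
move=> maxf fx0; apply/negPn/negP=> gxf.
pose F0 (z : uT * k^o) := f z.1 + z.2 *: g x; pose G0 (z : uT * k^o) := g z.1.
have linF : linear F0.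
  move=> c y z; rewrite /F0 /= linearP /= scalerDr !scalerDl scalerA.
  by rewrite addrACA.
have linG : linear G0 by move=> c y z; rewrite /G0 /= linearP.
have [p nzp le_p] := rank_pencil (linfun F0) (linfun G0).
have [|c] := k_infinite (p := p * 'X); first by rewrite mulf_neq0 ?polyX_eq0.
rewrite hornerMX mulf_eq0 => /norP[/le_p le_c nzc].
have sub1 : (limg (c *: linfun F0 + linfun G0)%R <= limg (c *: f + g)%R)%VS.
  apply/subvP=> _ /memv_imgP[z _ ->].
  rewrite add_lfunE scale_lfunE !linfun_linE // /F0 /G0 scalerDr addrAC.
  rewrite memvD //; first by rewrite -scale_lfunE -add_lfunE memv_img ?memvf.
  rewrite !memvZ //; apply/memv_imgP; exists x; rewrite ?memvf //.
  by rewrite add_lfunE scale_lfunE fx0 scaler0 add0r.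
have sub2 : (limg f + <[g x]> <= limg (linfun F0))%VS.
  rewrite subv_add -memvE; apply/andP; split.
    apply/subvP=> _ /memv_imgP[y _ ->]; apply/memv_imgP; exists (y, 0).
      exact: memvf.
    by rewrite linfun_linE // /F0 /= scale0r addr0.
  apply/memv_imgP; exists (0, 1); first exact: memvf.
  by rewrite linfun_linE // /F0 /= linear0 add0r scale1r.
have lt : (\dim (limg f) < \dim (limg f + <[g x]>))%N.
  rewrite ltnNge; apply: contra gxf => le.
  have : (limg f == limg f + <[g x]>)%VS by rewrite eqEdim addvSl.
  by move/eqP->; rewrite memvE addvSr.
have := leq_trans lt (dimvS sub2); rewrite ltnNge => /negP[].
exact: leq_trans le_c (leq_trans (dimvS sub1) (maxf c)).
Qed.

Lemma nat_max (Q : nat -> Prop) (b : nat) : (exists m, Q m) -> (forall m, Q m -> m <= b)%N ->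
  exists2 m, Q m & (forall m', Q m' -> m' <= m)%N.
Proof.
elim: b => [|b IHb] [m Qm] le_b.
  by exists m => // m' /le_b; rewrite leqn0 => /eqP->.
have [Qb | nQb] := classic (Q b.+1); first by exists b.+1.
apply: IHb; first by exists m.
move=> m' Qm'; have := le_b m' Qm'; rewrite leq_eqVlt => /predU1P[m'E|//].
by case: nQb; rewrite -m'E.
Qed.

Definition pair_sum (V : {vspace M}) v w : {vspace M} := (coset V v + coset V w)%VS.

Definition max_pair (V : {vspace M}) v w : Prop :=
  [/\ v \in V, w \in V & forall v' w', v' \in V -> w' \in V ->
      (\dim (pair_sum V v' w') <= \dim (pair_sum V v w))%N].

(** This map is linear in the pair (v, w) and has image [pair_sum (im T) v w], so statements on
    pencils apply to pairs. *)
Definition pair_map T v w : 'Hom((M * M)%type, M) :=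
  linfun (fun z : (M * M)%type => v * T z.1 + w * T z.2).

Lemma pair_mapE T v w (z : (M * M)%type) : pair_map T v w z = v * T z.1 + w * T z.2.
Proof.
rewrite linfun_linE // => c y y'.
by rewrite /= !linearP /= !mulrDr -!scalerAr scalerDr addrACA.
Qed.

Lemma limg_pair_map T v w : limg (pair_map T v w) = pair_sum (im T) v w.
Proof.
have memC z x : z \in im T -> z * x \in coset (im T) x.
  by move=> Tz; rewrite /coset memv_mul ?memv_line.
apply: vspaceM_eq => x; apply/idP/idP.
  case/memv_imgP=> z _ ->; rewrite pair_mapE ![_ * T _]mulrC.
  by apply: memv_add; apply: memC; apply: limgT_mem.
case/sumvP=> _ /cosetP[p /memv_imgP[y _ ->] ->].
case=> _ /cosetP[q /memv_imgP[z _ ->] ->] ->.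
apply/memv_imgP; exists (y, z); first exact: memvf.
by rewrite pair_mapE ![_ * T _]mulrC.
Qed.

Lemma pair_map_lin T c v w v' w' :
  c *: pair_map T v w + pair_map T v' w' = pair_map T (c *: v + v') (c *: w + w').
Proof.
apply/lfunP=> z; rewrite add_lfunE scale_lfunE !pair_mapE.
by rewrite scalerDr !scalerAl addrACA -!mulrDl.
Qed.

Lemma max_pair_ex (V : {vspace M}) : exists v w, max_pair V v w.
Proof.
pose Q d := exists v w, [/\ v \in V, w \in V & \dim (pair_sum V v w) = d].
have [|m Qm|d [v [w [Vv Vw dE]]] maxd] := @nat_max Q (\dim (fullv : {vspace M})).
- by exists (\dim (pair_sum V 0 0)), 0, 0; rewrite mem0v.
- by case: Qm => v [w [_ _ <-]]; apply/dimvS/subvf.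
exists v, w; split=> // v' w' Vv' Vw'; rewrite dE; apply: maxd.
by exists v', w'.
Qed.

Lemma max_pair_tangent T v w x y v' w' : max_pair (im T) v w ->
  x \in im T -> y \in im T -> v * x + w * y = 0 -> v' \in im T -> w' \in im T ->
  v' * x + w' * y \in pair_sum (im T) v w.
Proof.
case=> Tv Tw maxvw /memv_imgP[x0 _ ->] /memv_imgP[y0 _ ->] E Tv' Tw'.
rewrite -limg_pair_map -[v' * _ + _](pair_mapE T v' w' (x0, y0)).
apply: pencil_tangent; last by rewrite pair_mapE.
by move=> c; rewrite pair_map_lin !limg_pair_map maxvw // memvD ?memvZ.
Qed.

Lemma max_pair_move T v w u : max_pair (im T) v w -> u \in im T ->
  exists2 c, c != 0 & max_pair (im T) (c *: v + u) (c *: w).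
Proof.
move=> [Tv Tw maxvw] Tu.
have [p nzp le_p] := rank_pencil (pair_map T v w) (pair_map T u 0).
(* The factor 'X forces c to be nonzero. *)
have [|c] := k_infinite (p := p * 'X); first by rewrite mulf_neq0 ?polyX_eq0.
rewrite hornerMX mulf_eq0 => /norP[/le_p le_c nzc]; exists c => //.
rewrite pair_map_lin addr0 !limg_pair_map in le_c.
split; rewrite ?memvD ?memvZ // => v' w' Tv' Tw'.
exact: leq_trans (maxvw v' w' Tv' Tw') le_c.
Qed.

Lemma im_step T a : a != 0 -> (im (T + conj a T) <= im T + coset (im T) a)%VS.
Proof. by move=> nza; apply: subv_trans (limgD_sub _ _) _; rewrite limg_conj. Qed.

(** If no pair enlarged V = im T, all subspaces w'V would coincide and V would be a line over a
    subfield, of dimension a power of 2; none lies strictly above 2^n and at most at 3 * 2^(n-1). *)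
Lemma max_pair_dim T n v w : normal_form T -> max_pair (im T) v w ->
  (2 ^ n < rk T)%N -> (2 * rk T <= 3 * 2 ^ n)%N ->
  (rk T < \dim (pair_sum (im T) v w))%N.
Proof.
move=> nT [Tv Tw maxvw] lt_n le_n; rewrite ltnNge; apply/negP=> le_rk.
have nz : im T != 0%VS by rewrite -dimv_eq0; lia.
pose v0 := vpick (im T); have nzv0 : v0 != 0 by rewrite vpick0.
have Tv0 : v0 \in im T by rewrite memv_pick.
have cosetE w' : w' \in im T -> (coset (im T) w' <= coset (im T) v0)%VS.
  move=> Tw'; have le := leq_trans (maxvw v0 w' Tv0 Tw') le_rk.
  have /eqP-> : (coset (im T) v0 == pair_sum (im T) v0 w')%VS.
    by rewrite eqEdim addvSl /= dim_coset.
  exact: addvSr.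
have memC x y : x \in im T -> y \in im T -> x * y / v0 \in im T.
  move=> Tx Ty; rewrite -mem_coset //; apply: (subvP (cosetE y Ty)).
  exact: mem_coset_mul.
have [E EP] : exists E : {subfield M}, forall x, x \in E <-> x * v0 \in im T.
  apply: subfield_of_pred => [|c x y Px Py|x y Px Py].
  - by rewrite mul1r.
  - by rewrite mulrDl -scalerAl memvD ?memvZ.
  - by have := memC _ _ Px Py; rewrite mulrACA mulrA mulfK.
have imT : im T = coset E v0.
  apply: vspaceM_eq => x; rewrite mem_coset //; apply/idP/idP => [Tx|/EP].
    by apply/EP; rewrite divfK.
  by rewrite divfK.
have [j dE] := dim_subfield E.
move: lt_n le_n; rewrite imT dim_coset // dE; clear => lt_n le_n.
have : (n < j)%N by rewrite -(ltn_exp2l (m := 2)).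
move=> nj; have : (2 ^ n.+1 <= 2 ^ j)%N by rewrite leq_exp2l.
by rewrite expnS; lia.
Qed.

(** Used with D = rk T, e the dimension of the intersection of V and aV, and 2^r the degree of a
    field acting on V + aV, whose dimension is 2 D - e. As a multiple of 2^r beyond 2^(n+1), it is
    at least 2^(n+1) + 2^r. *)
Lemma arith_pair (n r D e : nat) : (2 ^ r %| 2 * D - e)%N -> (e <= 2 ^ r)%N ->
  (0 < e)%N -> (2 ^ n.+1 < 2 * D - e)%N -> (D - e <= 2 ^ n)%N ->
  (2 * D <= 3 * 2 ^ n)%N ->
  [/\ e = 2 ^ r, D = 2 ^ n + 2 ^ r & 2 * 2 ^ r <= 2 ^ n]%N.
Proof.
move=> dvd le_e e0 lt le_D le2D.
have [le_r | lt_r] := leqP r n.+1; last first.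
  have : (2 ^ n.+2 <= 2 ^ r)%N by rewrite leq_exp2l.
  have := dvdn_leq _ dvd; rewrite !expnS in lt *; lia.
have /dvdnP[p pE] : (2 ^ r %| 2 ^ n.+1)%N by apply: dvdn_exp2l.
have /dvdnP[q qE] := dvd.
have lt_pq : (p < q)%N.
  by rewrite -(ltn_pmul2r (m := 2 ^ r)) ?expn_gt0 // -pE -qE.
have : (2 ^ n.+1 + 2 ^ r <= 2 * D - e)%N.
  by rewrite qE pE addnC -mulSn leq_mul2r lt_pq orbT.
by rewrite expnS in lt *; move=> H; split; lia.
Qed.

(** The gap above the Hauptsatz bound; doubling the upper inequality avoids 2^(n-1), so n = 0 is
    covered. *)
Definition rank_gap n := forall T, Ipow n T -> (2 ^ n < rk T)%N ->
  (2 * rk T < 3 * 2 ^ n)%N -> False.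

(* For a maximal pair of slope a, either T lies inside <<a>> T, or this holds
   after splitting off a subform of dimension 2^r. *)
Record pair_data T n v w (a := w / v) (Ta := T + conj a T)
    (Va := (im T :&: coset (im T) a)%VS) : Prop := PairData {
  pd_nzv : v != 0;
  pd_nza : a != 0;
  pd_v : v \in Va;
  pd_w : w \in Va;
  pd_rk : rk Ta = (2 ^ n.+1)%N;
  pd_im : forall y, y \in im Ta -> y != 0 -> im Ta = coset (cent Ta) y;
  pd_cases :
    (im T <= im Ta)%VS /\ \dim (pair_sum (im T) v w) = (2 ^ n.+1)%N \/
    exists r R, [/\ \dim Va = (2 ^ r)%N, rk T = (2 ^ n + 2 ^ r)%N,
      (2 * 2 ^ r <= 2 ^ n)%N, (2 ^ n.+1 < \dim (pair_sum (im T) v w))%N &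
      [/\ sub_form R T, im R = Va, sub_form (T + R) Ta &
          (im T :&: im Ta)%VS = im (T + R)]] }.

Lemma dim_pair_sum (V : {vspace M}) v w : v != 0 ->
  \dim (pair_sum V v w) = \dim (V + coset V (w / v)).
Proof.
move=> nzv; rewrite -[RHS](dim_coset _ nzv); congr (\dim _).
apply: vspaceM_eq => x; rewrite mem_coset //; apply/sumvP/sumvP.
  case=> _ /cosetP[p Vp ->] [_ /cosetP[q Vq ->] ->].
  exists p => //; exists (q * (w / v)); first exact: mem_coset_mul.
  by rewrite mulrDl (mulfK nzv) mulrA.
case=> p Vp [_ /cosetP[q Vq ->] xE].
exists (p * v); first exact: mem_coset_mul.
exists (q * w); first exact: mem_coset_mul.
by rewrite -[x](divfK nzv) xE mulrDl -!mulrA mulVf ?mulr1.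
Qed.

Lemma pair_dataP T n v w : rank_gap n.+1 -> Ipow n T -> max_pair (im T) v w ->
  (2 ^ n < rk T)%N -> (2 * rk T <= 3 * 2 ^ n)%N -> pair_data T n v w.
Proof.
move=> gapS IT mp lt_n le_n; have nT := Ipow_normal IT.
have lt_X := max_pair_dim nT mp lt_n le_n; have [Tv Tw maxvw] := mp.
have le_coset z : (\dim (coset (im T) z) <= rk T)%N.
  by have [-> | nzz] := eqVneq z 0; rewrite ?coset0 ?dimv0 ?dim_coset.
have nzv : v != 0.
  by apply: contraTneq lt_X => ->; rewrite -leqNgt /pair_sum coset0 add0v.
have nzw : w != 0.
  by apply: contraTneq lt_X => ->; rewrite -leqNgt /pair_sum coset0 addv0.
rewrite dim_pair_sum // in lt_X.
pose a := w / v; have nza : a != 0 by rewrite mulf_neq0 ?invr_eq0.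
pose Va := (im T :&: coset (im T) a)%VS; pose Y := (im T + coset (im T) a)%VS.
pose Ta := T + conj a T.
have ITa : Ipow n.+1 Ta by apply: Ipow_step.
have Vw : w \in Va by rewrite memv_cap Tw mem_coset // invfM invrK mulrCA mulrA mulVf ?mul1r.
have Vv : v \in Va.
  rewrite memv_cap Tv mem_coset // invfM invrK [w^-1 * v]mulrC mulrA iotaP.
  by rewrite mulr_algl memvZ ?memV_inv.
have dY : (\dim Y + \dim Va = 2 * rk T)%N.
  by rewrite dimv_sum_cap dim_coset // mul2n addnn.
have e0 : (0 < \dim Va)%N by apply: dim_gt0 Vv nzv.
have sTaY : (im Ta <= Y)%VS by apply: im_step.
have Taa : a \in cent Ta by apply: cent_step.
have nzTa : im Ta != 0%VS.
  rewrite limg_eq0 step_eq0 //; apply: contraTN lt_X => Ta'; rewrite -leqNgt.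
  suff /eqP-> : (im T + coset (im T) a == im T)%VS by [].
  rewrite eqEsubv addvSl subv_add subvv /= !andbT; apply/subvP=> x.
  by rewrite mem_coset // => Tx; rewrite -[x](divfK nza) mulrC cent_im.
have haupt y : y \in im Ta -> y != 0 ->
    (2 ^ n.+1 <= rk Ta)%N /\ (rk Ta = (2 ^ n.+1)%N -> im Ta = coset (cent Ta) y).
  exact: Ipow_hauptsatz.
(* The rank is at most 2 rk T - dim Va < 3 * 2^n, and the gap for n + 1 then leaves only 2^(n+1). *)
have rkTa : rk Ta = (2 ^ n.+1)%N.
  have nzp : vpick (im Ta) != 0 by rewrite vpick0.
  have [ge _] := haupt _ (memv_pick _) nzp.
  have le := dimvS sTaY; apply/eqP; rewrite eqn_leq ge andbT leqNgt; apply/negP=> lt.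
  apply: (gapS _ ITa lt); rewrite expnS; move: le dY e0 le_n; clear; dlia.
have imTa y : y \in im Ta -> y != 0 -> im Ta = coset (cent Ta) y.
  by move=> Ty nzy; have [_ ->] := haupt y Ty nzy.
have VaM x : x \in Va -> a * x \in Va.
  rewrite !memv_cap !mem_coset // => /andP[Tx Tx']; apply/andP; split.
    by rewrite -[x](divfK nza) mulrCA iotaP mulrC mulr_algl memvZ.
  by rewrite [a * x]mulrC mulfK.
(* As w = a v, the terms v x and w (x/a) are equal and sum to 0, so maximality applies; dividing by
   v, multiplication by x/v takes V into Y. *)
have tangent x y : x \in Va -> y \in im T -> y * (x / v) \in Y.
  rewrite memv_cap mem_coset // => /andP[Tx Tx'] Ty.
  have xa : v * x + w * (x / a) = 0.
    have -> : w * (x / a) = v * x by rewrite /a; field; rewrite nzw nzv.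
    exact: addMM.
  have := max_pair_tangent mp Tx Tx' xa Ty (mem0v _); rewrite mul0r addr0.
  case/sumvP=> _ /cosetP[p Tp ->] [_ /cosetP[q Tq ->] E].
  rewrite mulrA E mulrDl mulfK // -mulrA; apply: memv_add => //.
  exact: mem_coset_mul.
have YVa x y : x \in Va -> y \in Y -> x / v * y \in Y.
  move=> Vx /sumvP[p Tp [_ /cosetP[q Tq ->] ->]].
  have -> : x / v * (p + q * a) = p * (x / v) + q * (a * x / v) by ring.
  by rewrite memvD ?tangent ?VaM.
(* The field stabilizing Y contains Va/v: its degree 2^r bounds dim Va from above and divides dim
   Y. *)
have [K KP] : exists K : {subfield M}, forall x, x \in K <->
    forall y, y \in Y -> x * y \in Y.
  apply: subfield_of_pred => [y|c x y Px Py z Yz|x y Px Py z Yz].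
  - by rewrite mul1r.
  - by rewrite mulrDl -scalerAl memvD ?memvZ ?Px ?Py.
  - by rewrite -mulrA Px ?Py.
have [r dK] := dim_subfield K.
have sVaK : (coset Va v^-1 <= K)%VS.
  apply/subvP=> x; rewrite mem_coset ?invr_eq0 // invrK => Vx; apply/KP=> y Yy.
  by rewrite -[x](mulfK nzv) YVa.
have le_e : (\dim Va <= 2 ^ r)%N.
  by rewrite -dK -(dim_coset Va (w := v^-1)) ?invr_eq0 // dimvS.
have dvd : (2 ^ r %| \dim Y)%N.
  rewrite -dK; apply: field_module_dimS; apply/prodvP=> x y Kx Yy.
  exact: (KP x).1.
have [R sRT imR] : exists2 R, sub_form R T & im R = Va.
  by apply: sub_form_ex => //; apply: capvSl.
have [sUT dU orthU Uorth] := sub_form_compl nT sRT.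
have [_ sUT' bU] := sUT.
have s_ker x y : x \in lker T -> s (x * T y) = 0.
  by rewrite memv_ker nT.1 => /eqP->; rewrite mul0r linear0.
have s_kera x y : x \in coset (lker T) a -> s (x * (T y * a)) = 0.
  case/cosetP=> z Tz ->.
  by rewrite mulrACA iotaP mulr_algr sZ s_ker ?mulr0.
(* On a ker T the term [conj a T] vanishes, so T and [Ta] agree there. By duality for s, T maps a
   ker T onto the complement of [Va], which is therefore a subform of [Ta] as well. *)
pose W := (T @: coset (lker T) a)%VS.
have sWU : (W <= im (T + R))%VS.
  apply/subvP=> _ /memv_imgP[x ax ->]; apply: Uorth; first exact: limgT_mem.
  move=> q; rewrite imR memv_cap => /andP[Tq].
  case/cosetP=> _ /memv_imgP[y _ ->] qE.
  by rewrite betaE // qE s_kera.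
have dW : (rk (T + R) <= \dim W)%N.
  have d1 := limg_ker_dim T (coset (lker T) a); rewrite dim_coset // in d1.
  have d2 := limg_ker_dim T fullv; rewrite capfv in d2.
  have d3 : (\dim (coset (lker T) a :&: lker T) + \dim Y <= \dim {:M})%N.
    apply: perp_dim => x y; rewrite memv_cap => /andP[ax kx].
    case/sumvP=> _ /memv_imgP[p _ ->] [_ /cosetP[_ /memv_imgP[q _ ->] ->] ->].
    by rewrite mulrDr sD s_ker // s_kera // addr0.
  move: d1 d2 d3 dU dY; rewrite imR -/W; clear; dlia.
have UW : im (T + R) = W by apply/esym/eqP; rewrite eqEdim sWU.
have Uz u : u \in im (T + R) -> exists2 z, T z = u & Ta z = u.
  rewrite UW => /memv_imgP[z]; rewrite mem_coset // memv_ker => /eqP za ->.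
  by exists z; rewrite // add_lfunE conjE mulrC mulrC [a^-1 * z]mulrC za mulr0 addr0.
have nTa := Ipow_normal ITa.
have sUTa : sub_form (T + R) Ta.
  have sU : (im (T + R) <= im Ta)%VS.
    by apply/subvP=> u /Uz[z _ <-]; apply: limgT_mem.
  split=> //; first by case: sUT.
  move=> p q Up Uq; rewrite bU //; have [z zT zTa] := Uz p Up.
  by rewrite -[in LHS]zT -[in RHS]zTa !betaE ?(subvP sU) ?(subvP sUT').
have [_ sUTa' _] := sUTa.
have capUV : (im (T + R) :&: Va = 0)%VS.
  apply/eqP; rewrite -subv0; apply/subvP=> p; rewrite memv_cap memv0 => /andP[Up Vp].
  by rewrite -iota_eq0 -(beta_diag nT (subvP sUT' _ Up)) orthU ?imR.
(* The complement U and its multiple aU are independent inside [im Ta], so dim U <= 2^n. *)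
have capUa : (im (T + R) :&: coset (im (T + R)) a = 0)%VS.
  apply/eqP; rewrite -subv0 -capUV; apply/subvP=> p.
  rewrite !memv_cap !mem_coset // => /andP[Up Up'].
  by rewrite Up !(subvP sUT').
have sUa : (im (T + R) + coset (im (T + R)) a <= im Ta)%VS.
  rewrite subv_add sUTa'; apply/subvP=> p /cosetP[q Uq ->].
  by rewrite mulrC cent_im // (subvP sUTa').
have dUa := dimv_disjoint_sum capUa; rewrite dim_coset // in dUa.
have le_Ua := dimvS sUa.
apply: (PairData (v := v) (w := w)) => //.
rewrite dim_pair_sum //.
have [dYE | ne] := eqVneq (\dim Y) (2 ^ n.+1)%N.
  left; split=> //; suff /eqP-> : im Ta == Y by apply: addvSl.
  by rewrite eqEdim sTaY rkTa; move: dYE; clear; dlia.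
right; exists r, R.
have [eE DE le_r] : [/\ \dim Va = 2 ^ r, rk T = 2 ^ n + 2 ^ r & 2 * 2 ^ r <= 2 ^ n]%N.
  have YE : \dim Y = (2 * rk T - \dim Va)%N by move: dY; clear; dlia.
  have := dimvS sTaY; rewrite rkTa leq_eqVlt eq_sym (negPf ne) /= => lt_Y.
  apply: arith_pair => //; rewrite -?YE //.
  by move: dU le_Ua; rewrite imR dUa rkTa expnS; clear; dlia.
split=> //.
  by rewrite ltn_neqAle eq_sym ne -rkTa dimvS.
split=> //.
have imTaU : (im (T + R) + coset (im (T + R)) a)%VS = im Ta.
  apply/eqP; rewrite eqEdim sUa dUa rkTa expnS /=.
  by move: dU; rewrite imR eE DE; clear; dlia.
have TE : im T = (im (T + R) + Va)%VS.
  apply/esym/eqP; rewrite eqEdim subv_add sUT' capvSl /= dimv_disjoint_sum //.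
  by move: dU; rewrite imR; clear; dlia.
(* Y lies in the sum of [Va] and [im Ta] and its dimension is the sum of theirs, so the sum is
   direct. *)
have capTa : (Va :&: im Ta = 0)%VS.
  have sY : (Y <= Va + im Ta)%VS.
    rewrite subv_add; apply/andP; split.
      by rewrite TE subv_add addvSl andbT (subv_trans sUTa') ?addvSr.
    apply/subvP=> x /cosetP[p Tp ->]; move: Tp; rewrite TE => /sumvP[u Uu [q Vq ->]].
    rewrite mulrDl addrC memv_add // mulrC ?VaM //.
    by rewrite cent_im // (subvP sUTa').
  have := dimv_sum_cap Va (im Ta); have := dimvS sY.
  move=> le dsum; apply/eqP; rewrite -dimv_eq0.
  by move: dY le dsum; rewrite eE DE rkTa expnS; clear; dlia.
apply: vspaceM_eq => p; rewrite memv_cap; apply/andP/idP => [[Tp Tap]|Up].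
  have : p \in (im (T + R) + Va)%VS.
    by rewrite -TE.
  case/sumvP=> u Uu [q Vq pE].
  suff q0 : q = 0 by rewrite pE q0 addr0.
  apply/eqP; rewrite -memv0 -capTa memv_cap Vq.
  have -> : q = p - u by rewrite pE addrAC subrr add0r.
  exact: memvB Tap (subvP sUTa' _ Uu).
by rewrite (subvP sUT') ?(subvP sUTa').
Qed.

Lemma arith_field (n i D : nat) : (2 ^ n < D)%N -> (2 * D <= 3 * 2 ^ n)%N ->
  (2 ^ n.+1 <= 2 ^ i + D)%N -> (2 ^ i %| D)%N ->
  (2 * 2 ^ i = 2 ^ n)%N /\ (2 * D = 3 * 2 ^ n)%N.
Proof.
rewrite expnS => lt_n le_n le dvd; have [le_i | lt_i] := leqP n i.
  have /dvdnP[q qE] : (2 ^ n %| D)%N by apply: dvdn_trans dvd; apply: dvdn_exp2l.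
  have : (1 < q)%N by rewrite -(ltn_pmul2r (m := 2 ^ n)) ?expn_gt0 // mul1n -qE.
  have : (q < 2)%N.
    rewrite -(ltn_pmul2r (m := 2 ^ n)) ?expn_gt0 // -qE.
    by have := expn_gt0 2 n; lia.
  by lia.
have : (2 ^ i.+1 <= 2 ^ n)%N by rewrite leq_exp2l.
by rewrite expnS; lia.
Qed.

(** Let L = [cent Ta], of degree 2^(n+1), and scale T to T' with image inside L. For l in L the
    operator <<l>> T' lies in I^(n+1) and has image in L, so it is 0 or has image L and commutes
    with L. If x in ker T' is not orthogonal to L, then T'(l x) = 0 excludes the second case. So the
    kernel of l |-> T'(l x) on L lies in E, and 2^(n+1) <= dim E + rk T. *)
Lemma rank_dichotomy_field n T v w : Ipow n T -> (2 ^ n < rk T)%N -> (2 * rk T <= 3 * 2 ^ n)%N ->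
  pair_data T n v w -> (im T <= im (T + conj (w / v) T))%VS ->
  exists E : {subfield M},
    [/\ {subset E <= cent T}, (2 * \dim E = 2 ^ n)%N & (2 * rk T = 3 * 2 ^ n)%N].
Proof.
move=> IT lt_n le_n [nzv nza]; rewrite memv_cap => /andP[Tv _] _ rkTa imTa _ sTTa.
set Ta := T + _ in rkTa imTa sTTa; pose L := cent Ta.
have imTaL : im Ta = coset L v by apply: imTa; rewrite ?(subvP sTTa).
have dL : \dim L = (2 ^ n.+1)%N by rewrite -rkTa imTaL dim_coset.
have nzv' : v^-1 != 0 by rewrite invr_eq0.
pose T' := conj v^-1 T.
have IT' : Ipow n T' by apply: Ipow_conj.
have rkT' : rk T' = rk T by apply: rk_conj.
have nT' := Ipow_normal IT'.
have sT'L x : x \in im T' -> x \in L.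
  rewrite limg_conj // mem_coset // invrK => /(subvP sTTa).
  by rewrite imTaL mem_coset // mulfK.
have full l : l \in L -> l != 0 -> T' + conj l T' != 0 ->
    im (T' + conj l T') = L /\ {subset L <= cent (T' + conj l T')}.
  move=> Ll nzl; set S := T' + _ => nzS.
  have IS : Ipow n.+1 S by apply: Ipow_step.
  have sSL : (im S <= L)%VS.
    apply: subv_trans (im_step _ nzl) _; rewrite subv_add; apply/andP; split.
      by apply/subvP.
    apply/subvP=> _ /cosetP[x Tx ->]; exact: subfieldM (sT'L _ Tx) Ll.
  have nzp : vpick (im S) != 0 by rewrite vpick0 limg_eq0.
  have [ge _] := Ipow_hauptsatz IS (memv_pick _) nzp.
  have SL : im S = L.
    by apply/eqP; rewrite eqEdim sSL dL.
  have S1 : 1 \in im S by rewrite SL mem1v.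
  have [_ cS] := Ipow_hauptsatz IS S1 (oner_neq0 _).
  split=> // m; rewrite -SL cS; last by rewrite SL.
  by rewrite mem_coset ?oner_neq0 // divr1.
have [x kx [l0 Ll0 sx]] : exists2 x, T' x = 0 & exists2 l, l \in L & s (l * x) != 0.
  apply: NNPP => nex.
  have := limg_ker_dim T' fullv; rewrite capfv rkT'.
  have : (\dim (lker T') + \dim L <= \dim {:M})%N.
    apply: perp_dim => x y; rewrite memv_ker => /eqP kx Ly.
    apply/eqP/negPn/negP=> sx; apply: nex; exists x => //; exists y => //.
    by rewrite mulrC.
  move: lt_n le_n; rewrite dL expnS; clear; dlia.
have centT' l : l \in L -> T' (l * x) = 0 -> l \in cent T'.
  have [-> _ _ | nzl] := eqVneq l 0; first exact: mem0v.
  move=> Ll lx; rewrite -step_eq0 //; apply/negPn/negP=> nzS.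
  have [SL cS] := full l Ll nzl nzS; set S := T' + _ in SL cS.
  have Slx : S (l * x) = 0 by rewrite add_lfunE conjE mulKf // kx lx mulr0 addr0.
  have Sx : S x = 0.
    have /centP/(_ x) := cS _ Ll; rewrite Slx => /esym/eqP.
    by rewrite mulf_eq0 (negPf nzl) => /eqP.
  have nS : normal_form S by apply: normalD => //; apply: normal_conj.
  (* In the second case x is killed by S, hence orthogonal to [im S] = L, against the choice of
     x. *)
  move: Ll0; rewrite -SL => /memv_imgP[y _ l0E].
  by move: sx; rewrite l0E -nS.1 Sx mulr0 linear0 eqxx.
pose E := (L :&: cent T')%AS; exists E.
have sET : {subset E <= cent T}.
  by move=> l /memv_capP[_ T'l]; rewrite -(cent_conj T l nzv').
suff [-> ->] : (2 * \dim E = 2 ^ n)%N /\ (2 * rk T = 3 * 2 ^ n)%N by [].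
(* Since dim E divides rk T, dim E is at most 2^(n-1); then rk T >= 2^(n+1) - 2^(n-1), which meets
   the upper bound. *)
have [i dE] := dim_subfield E; rewrite dE; apply: arith_field => //; last first.
  rewrite -dE; apply: field_module_dimS; apply/prodvP=> l y /sET Tl Ty.
  exact: cent_im.
rewrite -dL -(limg_ker_dim (T' \o amulr x)%VF) -dE -rkT' leq_add //.
  apply: dimvS; apply/subvP=> l /memv_capP[Ll].
  rewrite memv_ker comp_lfunE [amulr x l]lfunE => /eqP lx.
  by apply/memv_capP; split=> //; apply: centT'.
apply: dimvS; apply/subvP=> _ /memv_imgP[l _ ->].
by rewrite comp_lfunE limgT_mem.
Qed.

(* Moving v to another generic v' = c v + u changes the field L = cent Ta; on the
   complement P of Va + Va' the form T agrees with both Ta and Ta', so P lies in a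
   line over Z = L :&: L', on which Ta restricts to the Pfister form Tp. *)
Lemma rank_dichotomy_split n T v w : rank_gap n.+1 -> Ipow n T -> max_pair (im T) v w ->
  (2 ^ n < rk T)%N -> (2 * rk T <= 3 * 2 ^ n)%N ->
  pair_data T n v w -> ~~ (\dim (pair_sum (im T) v w) <= 2 ^ n.+1)%N ->
  exists Tp r, [/\ Ipow n Tp, rk Tp = (2 ^ n)%N, rk T = (2 ^ n + 2 ^ r)%N,
    (2 * 2 ^ r <= 2 ^ n)%N & (rk (T + Tp) + 2 <= 3 * 2 ^ r)%N].
Proof.
move=> gapS IT mp lt_n le_n pd ltX; have nT := Ipow_normal IT.
have [nzv nza Vv Vw rkTa imTa] := pd.
set a := w / v in nza Vv Vw rkTa imTa *; set Ta := T + conj a T in rkTa imTa *.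
set Va := (_ :&: _)%VS in Vv Vw *.
case=> [[_ le]|[r [R [dV DE le_r _ [sRT imR sUTa UE]]]]].
  by rewrite le leqnn in ltX.
have [sUT dU orthU Uorth] := sub_form_compl nT sRT.
have nzU : im (T + R) != 0%VS.
  rewrite -dimv_eq0; move: dU (expn_gt0 2 n); rewrite imR dV DE; clear; dlia.
pose u := vpick (im (T + R)); have nzu : u != 0 by rewrite vpick0.
have Uu : u \in im (T + R) by apply: memv_pick.
have Tu : u \in im T by have [_ /subvP sU _] := sUT; apply: sU.
have [c nzc mp'] := max_pair_move mp Tu.
have := pair_dataP gapS IT mp' lt_n le_n.
set v' := c *: v + u in mp' *; set w' := c *: w in mp' *.
case=> nzv' nza' Vv' Vw' rkTa' imTa'.
set a' := w' / v' in nza' Vv' Vw' rkTa' imTa' *.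
set Ta' := T + conj a' T in rkTa' imTa' *.
set Va' := (_ :&: _)%VS in Vv' Vw' *.
have [[Tv Tw maxvw] [Tv' Tw' maxvw']] := (mp, mp').
case=> [[_ le]|[r' [R' [dV' DE' _ _ [sRT' imR' sUTa' UE']]]]].
  by move: ltX; rewrite -le maxvw'.
have rr : (2 ^ r' = 2 ^ r)%N by move: DE'; rewrite DE => /addnI.
have nVv' : v' \notin Va.
  apply: contra nzu => Vv1; rewrite -iota_eq0 -(beta_diag nT Tu) orthU // imR.
  have -> : u = v' - c *: v by rewrite /v' addrAC subrr add0r.
  by rewrite memvB ?memvZ.
have nzw : w != 0 by apply: contraNneq nza => w0; rewrite /a w0 mul0r.
(* The vector w lies in both [Va] and [Va'], because w' is a nonzero multiple of it. The dimension
   so gained accounts for the 2 in the final bound on the rank of T + Tp. *)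
pose Q := (Va + Va')%VS.
have dQ : (\dim Q < 2 * 2 ^ r)%N.
  have := dimv_sum_cap Va Va'; rewrite dV dV' rr.
  have Vw1 : w \in Va' by rewrite -[w](scalerK nzc) memvZ.
  have /dim_gt0/(_ nzw) : w \in (Va :&: Va')%VS by rewrite memv_cap Vw Vw1.
  rewrite -/Q; clear; dlia.
have sQT : (Q <= im T)%VS by rewrite subv_add !capvSl.
have [R2 sR2T imR2] := sub_form_ex nT sQT.
have [[_ sPT _] dP orthP _] := sub_form_compl nT sR2T.
pose P := im (T + R2).
have sPU p : p \in P -> p \in im (T + R).
  move=> Pp; apply: Uorth; first exact: (subvP sPT).
  by move=> q; rewrite imR => Vq; rewrite orthP // imR2 (subvP (addvSl _ _)).
have [sUT' dU' orthU' Uorth'] := sub_form_compl nT sRT'.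
have sPU' p : p \in P -> p \in im (T + R').
  move=> Pp; apply: Uorth'; first exact: (subvP sPT).
  by move=> q; rewrite imR' => Vq; rewrite orthP // imR2 (subvP (addvSr _ _)).
have dP' : (2 ^ n + 2 ^ r < \dim P + 2 * 2 ^ r)%N.
  by move: dP dQ; rewrite imR2 DE -/P; clear; dlia.
have [_ sUTa1 bUTa] := sUTa; have [_ sUTa1' _] := sUTa'; have [_ _ bUT] := sUT.
have nzP : P != 0%VS by rewrite -dimv_eq0; move: dP' le_r; clear; dlia.
pose p0 := vpick P; have nzp0 : p0 != 0 by rewrite vpick0.
have Pp0 : p0 \in P by apply: memv_pick.
have imE : im Ta = coset (cent Ta) p0.
  by apply: imTa => //; apply/(subvP sUTa1)/sPU.
have imE' : im Ta' = coset (cent Ta') p0.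
  by apply: imTa' => //; apply/(subvP sUTa1')/sPU'.
pose Z := (cent Ta :&: cent Ta')%AS.
have PZ p : p \in P -> p \in coset Z p0.
  move=> Pp; rewrite mem_coset // memv_cap -!mem_coset // -imE -imE'.
  by rewrite (subvP sUTa1) ?sPU // (subvP sUTa1') ?sPU'.
have dPZ : (\dim P <= \dim Z)%N.
  by rewrite -(dim_coset Z nzp0); apply: dimvS; apply/subvP.
have dL : \dim (cent Ta) = (2 ^ n.+1)%N by rewrite -rkTa imE dim_coset.
have dL' : \dim (cent Ta') = (2 ^ n.+1)%N by rewrite -rkTa' imE' dim_coset.
(* If Z were all of L, both pairs would give the same complement, hence R = R' and v' in [Va]. From
   below, dim P > 2^n - 2^r >= 2^(n-1). *)
have dZ : \dim Z = (2 ^ n)%N.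
  have [j dZ] := dim_subfield Z.
  have lt_Z : (\dim Z < 2 ^ n.+1)%N.
    rewrite ltnNge; apply/negP=> le_Z.
    have ZE : Z = cent Ta :> {vspace M} by apply/eqP; rewrite eqEdim capvSl dL.
    have ZE' : Z = cent Ta' :> {vspace M} by apply/eqP; rewrite eqEdim capvSr dL'.
    have UU : im (T + R) = im (T + R') by rewrite -UE -UE' imE imE' -ZE -ZE'.
    have TRR := sub_form_uniq sUT sUT' UU.
    case/negP: nVv'; rewrite -imR (addrI T TRR) imR'; exact: Vv'.
  have lt_j : (n < j.+1)%N.
    rewrite -(ltn_exp2l (m := 2)) // expnS -dZ.
    by move: dPZ dP' le_r; clear; dlia.
  rewrite dZ ltn_exp2l // in lt_Z.
  have jn : j = n by move: lt_j lt_Z; clear; lia.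
  by rewrite dZ jn.
have nTa : normal_form Ta by apply: normalD => //; apply: normal_conj.
have sZTa : (coset Z p0 <= im Ta)%VS by rewrite imE subv_coset ?capvSl.
have [Tp sTp imTp] := sub_form_ex nTa sZTa; have [nTp _ bTp] := sTp.
have cTp : {subset Z <= cent Tp}.
  move=> z Zz; apply: (cent_sub_form nTa sTp); last first.
    by move=> x; rewrite imTp; apply: coset_stable.
  by move: Zz; rewrite memv_cap => /andP[].
exists Tp, r; split=> //.
- exact: (Ipow_field nTp cTp nzp0 imTp dZ).
- by rewrite imTp dim_coset.
have sPTp : (P <= im Tp)%VS by rewrite imTp; apply/subvP.
have := common_sub_form nT nTp sPT sPTp.
have bE : {in P &, forall p q, beta T p q = beta Tp p q}.
  move=> p q Pp Pq; rewrite bTp ?imTp ?PZ // -bUTa ?sPU //.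
  by rewrite -bUT ?sPU.
move/(_ bE); have rkTp : rk Tp = (2 ^ n)%N by rewrite imTp dim_coset.
by move: dP'; rewrite rkTp DE -/P; clear; dlia.
Qed.

Lemma rank_dichotomy n T : rank_gap n.+1 -> Ipow n T ->
    (2 ^ n < rk T)%N -> (2 * rk T <= 3 * 2 ^ n)%N ->
  (exists E : {subfield M}, [/\ {subset E <= cent T}, (2 * \dim E = 2 ^ n)%N &
    (2 * rk T = 3 * 2 ^ n)%N]) \/
  (exists Tp r, [/\ Ipow n Tp, rk Tp = (2 ^ n)%N, rk T = (2 ^ n + 2 ^ r)%N,
    (2 * 2 ^ r <= 2 ^ n)%N & (rk (T + Tp) + 2 <= 3 * 2 ^ r)%N]).
Proof.
move=> gapS IT lt_n le_n; have [v [w mp]] := max_pair_ex (im T).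
have pd := pair_dataP gapS IT mp lt_n le_n.
have [[sT dX] | [r [R [_ _ _ ltX _]]]] := pd_cases pd.
  by left; apply: rank_dichotomy_field pd sT.
by right; apply: rank_dichotomy_split pd _ => //; rewrite -ltnNge.
Qed.

Lemma Ipow_rk_ge n T : Ipow n T -> T != 0 -> (2 ^ n <= rk T)%N.
Proof.
move=> IT nzT; have nzp : vpick (im T) != 0 by rewrite vpick0 limg_eq0.
by have [] := Ipow_hauptsatz IT (memv_pick _) nzp.
Qed.

(** Strictly below 3 * 2^(n-1) the large similarity field is impossible, and in the other case r + 2
    <= n; the nonzero T + Tp would then be an element of I^n of rank below 2^(r+2) <= 2^n, against
    the Hauptsatz. *)
Lemma Ipow_rank_gap n : rank_gap n.
Proof.
have [m le_m] : exists m, (\dim (fullv : {vspace M}) < 2 ^ (n + m))%N.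
  exists (\dim (fullv : {vspace M})); rewrite expnD.
  by apply: leq_trans (ltn_expl _ (ltnSn 1)) _; rewrite leq_pmull ?expn_gt0.
elim: m n le_m => [|m IHm] n le_m T IT lt_n le_n.
  have T0 : T = 0 by apply: (Ipow_eq0 IT); rewrite -[n]addn0.
  by move: lt_n; rewrite T0 lim0g dimv0.
have gapS : rank_gap n.+1 by apply: IHm; rewrite addSnnS.
have [[E [_ _ E3]]|[Tp [r [ITp rkTp rkT le_r]]]] := rank_dichotomy gapS IT lt_n (ltnW le_n).
  by rewrite E3 ltnn in le_n.
have [T0 | nz] := eqVneq (T + Tp) 0.
  move=> _; have TTp : T = Tp by rewrite -[T](addTK Tp) T0 add0r.
  by move: lt_n; rewrite TTp rkTp ltnn.
have := Ipow_rk_ge (Ipow_add IT ITp) nz.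
rewrite rkT in lt_n le_n.
have lt_r : (r.+1 < n)%N.
  by rewrite -(ltn_exp2l (m := 2)) // expnS; lia.
have : (2 ^ r.+2 <= 2 ^ n)%N by rewrite leq_exp2l.
by rewrite !expnS; lia.
Qed.

(* The summand T1 is <<g>> T0 for the restriction T0 of T to a line over the
   field E when such a large field of similarities E exists, and Tp otherwise. *)
Lemma split_pfister n T : Ipow n T -> (2 * rk T = 3 * 2 ^ n)%N ->
  exists T1 T2, [/\ T = T1 + T2, Ipow n T1, Ipow n T2,
    rk T1 = (2 ^ n)%N & rk T2 = (2 ^ n)%N].
Proof.
move=> IT rkT; have nT := Ipow_normal IT; have n0 := expn_gt0 2 n.
have lt_n : (2 ^ n < rk T)%N by lia.
have le_n : (2 * rk T <= 3 * 2 ^ n)%N by lia.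
have split_of T1 : Ipow n T1 -> (rk T1 <= 2 ^ n)%N -> (rk (T + T1) <= 2 ^ n)%N ->
    exists T1 T2, [/\ T = T1 + T2, Ipow n T1, Ipow n T2,
      rk T1 = (2 ^ n)%N & rk T2 = (2 ^ n)%N].
  move=> IT1 le1 le2; exists T1, (T + T1).
  have IT2 := Ipow_add IT IT1.
  have TE : T = T1 + (T + T1) by rewrite addrC -addrA addTT addr0.
  have nz1 : T1 != 0.
    by apply: contraTneq lt_n => T10; rewrite -leqNgt -[T]addr0 -T10.
  have nz2 : T + T1 != 0.
    by apply: contraTneq lt_n => T20; rewrite -leqNgt TE T20 addr0.
  split=> //; apply/eqP; rewrite eqn_leq ?le1 ?le2 /=.
    exact: Ipow_rk_ge nz1.
  exact: Ipow_rk_ge nz2.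
have [[E [ET dE _]]|[Tp [r [ITp rkTp DE le_r le2]]]] :=
  rank_dichotomy (@Ipow_rank_gap n.+1) IT lt_n le_n; last first.
  apply: (split_of Tp) => //; first by rewrite rkTp.
  (* T + Tp has rank at most 3 * 2^r - 2 < 3 * 2^(n-1), so by the gap it is at most 2^n. *)
  rewrite leqNgt; apply/negP=> lt; apply: (Ipow_rank_gap (Ipow_add IT ITp) lt).
  by lia.
have nzT : im T != 0%VS by rewrite -dimv_eq0; lia.
pose v := vpick (im T); have nzv : v != 0 by rewrite vpick0.
have Tv : v \in im T by apply: memv_pick.
have sET : (coset E v <= im T)%VS.
  by apply/subvP=> _ /cosetP[x Ex ->]; rewrite cent_im ?ET.
have [T0 sT0 imT0] := sub_form_ex nT sET; have [nT0 _ _] := sT0.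
have [[_ sCT _] dC orthC Corth] := sub_form_compl nT sT0.
have cT0 : {subset E <= cent T0}.
  move=> z Ez; apply: (cent_sub_form nT sT0); first exact: ET.
  by move=> x; rewrite imT0; apply: coset_stable.
case: n => [|n] in IT rkT n0 lt_n le_n split_of dE *; first by move: dE; lia.
have dE' : \dim E = (2 ^ n)%N by move: dE; rewrite expnS; lia.
have IT0 : Ipow n T0 := Ipow_field nT0 cT0 nzv imT0 dE'.
have rkC : rk (T + T0) = (2 ^ n.+1)%N.
  by move: dC rkT; rewrite imT0 dim_coset // dE' expnS; clear; dlia.
pose v2 := vpick (im (T + T0)).
have nzv2 : v2 != 0 by rewrite vpick0 -dimv_eq0 rkC; lia.
have Cv2 : v2 \in im (T + T0) by apply: memv_pick.
have nzg : v2 / v != 0 by rewrite mulf_neq0 ?invr_eq0.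
have imX : im (conj (v2 / v) T0) = coset E v2.
  rewrite limg_conj // imT0; apply: vspaceM_eq => x; rewrite !mem_coset //.
  by rewrite invfM invrK mulrA mulfK.
apply: (split_of (T0 + conj (v2 / v) T0)).
- exact: Ipow_step.
- have := dimvS (limgD_sub T0 (conj (v2 / v) T0)).
  have := dimv_sum_cap (im T0) (im (conj (v2 / v) T0)).
  by rewrite imT0 imX !dim_coset // dE' expnS; clear; dlia.
rewrite -rkC addrA; apply: dimvS; apply: subv_trans (limgD_sub _ _) _.
rewrite subv_add subvv imX; apply/subvP=> _ /cosetP[x Ex ->].
by rewrite cent_im // centD ?ET ?cT0.
Qed.

(** * Linkage of the two Pfister summands *)

(** With N = ker (T1 + T2), both operators agree on N and map it into Q, while N meets ker T1 in the
    orthogonal of im T1 + im T2. In the equality case N maps onto Q, so vectors of Q have common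
    preimages and the two forms agree on Q. *)
Lemma rk_add_ge T1 T2 (Q := (im T1 :&: im T2)%VS) :
  normal_form T1 -> normal_form T2 ->
  (rk T1 + rk T2 <= rk (T1 + T2) + 2 * \dim Q)%N /\
  ((rk T1 + rk T2 = rk (T1 + T2) + 2 * \dim Q)%N ->
    forall p, p \in Q -> exists2 x, T1 x = p & T2 x = p).
Proof.
move=> nT1 nT2; pose N := lker (T1 + T2)%R.
have N_eq x : x \in N -> T1 x = T2 x.
  by rewrite memv_ker add_lfunE addr_eq0 oppM => /eqP.
have sNQ : (T1 @: N <= Q)%VS.
  apply/subvP=> _ /memv_imgP[x Nx ->].
  by rewrite memv_cap {2}(N_eq x Nx) !limgT_mem.
have d1 := limg_ker_dim T1 N; have d2 := limg_ker_dim (T1 + T2) fullv.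
rewrite capfv -/N in d2.
have d3 : (\dim (N :&: lker T1) + \dim (im T1 + im T2) <= \dim {:M})%N.
  apply: perp_dim => x y; rewrite memv_cap => /andP[Nx].
  rewrite memv_ker => /eqP T1x; have T2x : T2 x = 0 by rewrite -N_eq.
  case/sumvP=> _ /memv_imgP[p _ ->] [_ /memv_imgP[q _ ->] ->].
  by rewrite mulrDr sD nT1.1 nT2.1 T1x T2x !mul0r linear0 addr0.
have d4 := dimv_sum_cap (im T1) (im T2); rewrite -/Q in d4.
have d5 := dimvS sNQ.
split; first by move: d1 d2 d3 d4 d5; clear; dlia.
move=> dE p Qp; have NQ : (T1 @: N)%VS = Q.
  by apply/eqP; rewrite eqEdim sNQ /=; move: d1 d2 d3 d4 d5 dE; clear; dlia.
move: Qp; rewrite -NQ => /memv_imgP[x Nx ->]; exists x => //.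
by rewrite N_eq.
Qed.

Lemma Fadjoin_sum2 (E : {subfield M}) x :
  x \notin E -> <<E; x>>%VS = (E + coset E x)%VS.
Proof.
move=> xE; have nzx : x != 0 by apply: contraNneq xE => ->; apply: mem0v.
have cap0 : (E :&: coset E x = 0)%VS.
  apply/eqP; rewrite -subv0; apply/subvP=> z /memv_capP[Ez /cosetP[y Ey zE]].
  rewrite memv0 zE mulf_eq0 (negPf nzx) orbF; apply: contraNT xE => nzy.
  rewrite -[x](mulKf nzy); apply: subfieldM; first exact: memV_inv.
  by rewrite -zE.
apply/esym/eqP; rewrite eqEdim; apply/andP; split.
  rewrite subv_add subv_adjoin; apply/subvP=> _ /cosetP[y Ey ->].
  by rewrite memvM ?memv_adjoin // (subvP (subv_adjoin _ _)).
by rewrite dim_Fadjoin2 // dimv_disjoint_sum // dim_coset // mul2n addnn.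
Qed.

(** A subfield Y' on which g vanishes grows by any y in Y outside Y' with g(y Y') = 0. The space of
    such candidates has codimension at most dim Y', so it cannot lie in Y' while 2 dim Y' < dim
    Y. *)
Lemma isotropic_subfield (g : M -> k) (Y : {subfield M}) j i :
  (forall c u v, g (c *: u + v) = c * g u + g v) -> g 1 = 0 ->
  \dim Y = (2 ^ j)%N -> (i < j)%N ->
  exists Y' : {subfield M}, [/\ (Y' <= Y)%VS, \dim Y' = (2 ^ i)%N &
    forall y, y \in Y' -> g y = 0].
Proof.
move=> glin g1 dY; have g0 : g 0 = 0.
  by have := glin 1 0 0; rewrite scaler0 addr0 mul1r -{1}[g 0]addr0 => /addrI.
elim: i => [|i IHi] lt_i.
  exists 1%AS; rewrite sub1v dimv1; split=> // _ /vlineP[c ->].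
  by have := glin c 1 0; rewrite !addr0 g1 g0 mulr0 addr0.
have [Y' [sY' dY' gY']] := IHi (ltnW lt_i).
have [U [UP dU]] := ann_space Y Y' glin.
have : ~~ (U <= Y')%VS.
  apply: contraL lt_i => /dimvS; rewrite -leqNgt => le.
  rewrite -(leq_exp2l (m := 2)) // -dY expnS.
  by move: le dU; rewrite dY' ; clear; dlia.
case/subvPn=> y /UP[Yy gy] nY'y; exists <<Y'; y>>%AS.
have sY2 : (<<Y'; y>> <= Y)%VS by apply/FadjoinP.
split=> //; first by rewrite dim_Fadjoin2 // dY' expnS.
move=> z /=; rewrite Fadjoin_sum2 // => /sumvP[p Yp [_ /cosetP[q Yq ->] ->]].
by rewrite -[p]scale1r glin gY' // mulr0 add0r mulrC gy.
Qed.

(** The ranks force a common vector w in the images of T1 and T2. A common restriction R to a line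
    Y'w with Y' of degree 2^n gives Ti = <<xi, yi>> R; in the sum the two copies of R cancel and six
    terms remain. R itself is an n-fold Pfister multiple of [rank1 w]. *)
Lemma Ipow_shape n T : Ipow n.+2 T -> (2 * rk T = 3 * 2 ^ n.+2)%N ->
  exists cs w x1 y1 x2 y2,
    [/\ all (fun x => x != 0) cs, size cs = n,
        all (fun x => x != 0) [:: w; x1; y1; x2; y2] &
        T = pfister_op cs (\sum_(d <- [:: x1 * w; y1 * w; x1 * y1 * w;
                                          x2 * w; y2 * w; x2 * y2 * w]) rank1 d)].
Proof.
move=> IT rkT; have [T1 [T2 [TE IT1 IT2 rk1 rk2]]] := split_pfister IT rkT.
have [nT1 nT2] := (Ipow_normal IT1, Ipow_normal IT2).
have [le_Q eq_Q] := rk_add_ge nT1 nT2; rewrite -TE rk1 rk2 in le_Q eq_Q.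
set Q := (_ :&: _)%VS in le_Q eq_Q.
have n0 := expn_gt0 2 n.
have nzQ : Q != 0%VS.
  by rewrite -dimv_eq0; move: le_Q rkT n0; rewrite !expnS; clear; dlia.
pose w := vpick Q; have nzw : w != 0 by rewrite vpick0.
have : w \in Q by apply: memv_pick.
rewrite memv_cap => /andP[T1w T2w].
have [_ /(_ rk1) im1] := Ipow_hauptsatz IT1 T1w nzw.
have [_ /(_ rk2) im2] := Ipow_hauptsatz IT2 T2w nzw.
have dZ1 : \dim (cent T1) = (2 ^ n.+2)%N by rewrite -rk1 im1 dim_coset.
have dZ2 : \dim (cent T2) = (2 ^ n.+2)%N by rewrite -rk2 im2 dim_coset.
pose Y := (cent T1 :&: cent T2)%AS.
have QE : Q = coset Y w.
  apply: vspaceM_eq => x; rewrite mem_coset // !memv_cap -!mem_coset //.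
  by rewrite -im1 -im2.
have dQY : \dim Q = \dim Y by rewrite QE dim_coset.
have [j dY] := dim_subfield Y.
have le_j : (n <= j)%N.
  rewrite -(leq_exp2l (m := 2)) // -dY -dQY.
  by move: le_Q rkT; rewrite !expnS; clear; dlia.
pose g y := beta T1 w (w * y) + beta T2 w (w * y).
have [Y' [sY' dY' gY']] : exists Y' : {subfield M}, [/\ (Y' <= Y)%VS,
    \dim Y' = (2 ^ n)%N & forall y, y \in Y' -> g y = 0].
  (* If Y has degree above 2^n, there is room for a subfield killed by g, as g 1 = 0. If the degree
     is exactly 2^n, Y is the only candidate, but then [rk_add_ge] is an equality and common
     preimages show that g vanishes on Y. *)
  have [lt_j | le_j'] := ltnP n j.
    apply: (isotropic_subfield _ _ dY lt_j).
      move=> c u v; rewrite /g !mulrDr -!scalerAr !betaDr !betaZr; ring.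
    by rewrite /g mulr1 !beta_diag // addkk.
  have nj : n = j by apply/eqP; rewrite eqn_leq le_j le_j'.
  exists Y; split; [exact: subvv | by rewrite dY nj |].
  have dE : (2 ^ n.+2 + 2 ^ n.+2 = rk T + 2 * \dim Q)%N.
    by move: rkT; rewrite dQY dY -nj !expnS; clear; lia.
  have Qw : w \in Q by rewrite memv_cap T1w.
  move=> y Yy; have [x T1x T2x] := eq_Q dE w Qw.
  have : w * y \in Q by rewrite QE mulrC mem_coset_mul.
  rewrite memv_cap => /andP[T1y T2y].
  by rewrite /g -[w in beta T1 w _]T1x -[w in beta T2 w _]T2x !betaE // addkk.
have sYZ1 : (Y' <= cent T1)%VS by apply: subv_trans sY' (capvSl _ _).
have sYZ2 : (Y' <= cent T2)%VS by apply: subv_trans sY' (capvSr _ _).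
have sQ1 : (coset Y' w <= im T1)%VS by rewrite im1 subv_coset.
have sQ2 : (coset Y' w <= im T2)%VS by rewrite im2 subv_coset.
have [R sR1 imR] := sub_form_ex nT1 sQ1; have [nR _ bR] := sR1.
have sR2 : sub_form R T2.
  split=> //; rewrite imR // => _ _ /cosetP[a Ya ->] /cosetP[b Yb ->].
  rewrite bR ?imR ?mem_coset_mul //.
  have T1b : b * w \in im T1 by apply: (subvP sQ1); rewrite mem_coset_mul.
  have T2b : b * w \in im T2 by apply: (subvP sQ2); rewrite mem_coset_mul.
  rewrite (cent_beta nT1) ?(subvP sYZ1) // (cent_beta nT2) ?(subvP sYZ2) //.
  have -> : a * (b * w) = w * (a * b) by rewrite mulrCA [w * _]mulrC -mulrA mulrCA.
  by have := gY' _ (subfieldM Ya Yb); move/eqP; rewrite addr_eq0 oppk => /eqP.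
have cR : {subset Y' <= cent R}.
  move=> z Yz; apply: (cent_sub_form nT1 sR1); first exact: (subvP sYZ1).
  by move=> x; rewrite imR; apply: coset_stable.
have Rw : w \in im R by rewrite imR coset_self.
have im_w : im (rank1 w) = coset 1%AS w by rewrite im_rank1 // /coset prod1v.
have dY1 : \dim Y' = (2 ^ n * \dim (1%AS : {subfield M}))%N.
  by rewrite dY' dimv1 muln1.
have [cs [nzcs szcs RE]] := field_form_pfister nR cR nzw imR (sub1v _)
  (sub_form_rank1 nR Rw nzw) im_w dY1.
have dd1 : \dim (cent T1) = (2 ^ 2 * \dim Y')%N by rewrite dZ1 dY' -expnD.
have dd2 : \dim (cent T2) = (2 ^ 2 * \dim Y')%N by rewrite dZ2 dY' -expnD.
have [xs1 [nz1 sz1 T1E]] := field_form_pfister nT1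
  (fun _ => id) nzw im1 sYZ1 sR1 imR dd1.
case: xs1 nz1 sz1 T1E => [|x1 [|y1 [|? ?]]] //= nz1 _ T1E.
have [xs2 [nz2 sz2 T2E]] := field_form_pfister nT2
  (fun _ => id) nzw im2 sYZ2 sR2 imR dd2.
case: xs2 nz2 sz2 T2E => [|x2 [|y2 [|? ?]]] //= nz2 _ T2E.
exists cs, w, x1, y1, x2, y2; split=> //.
  by move: nz1 nz2; rewrite /= nzw !andbT => /andP[-> ->] /andP[-> ->].
rewrite !big_cons big_nil addr0 -!conj_rank1 !pfister_opD -!pfister_op_conj -RE.
rewrite TE T1E T2E /= !conjD !conjM.
set A := conj x1 R; set B := conj y1 R; set C := conj (x1 * y1) R.
set A' := conj x2 R; set B' := conj y2 R; set C' := conj (x2 * y2) R.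
have -> : R + B + (A + C) = R + (A + (B + C)) by rewrite -addrA (addrCA B).
have -> : R + B' + (A' + C') = R + (A' + (B' + C')) by rewrite -addrA (addrCA B').
by rewrite addrACA addTT add0r -!addrA.
Qed.

End Forms.

(** * From Gram matrices to operators *)

(** Only diagonal entries must come from M: off-diagonal ones enter as scalars, and these range over
    all of k. *)
Definition diag_lift m (B : 'M[k]_m) (b : 'I_m -> M) := forall i, iota (b i) = B i i.

Lemma invmx_uniq m (A X : 'M[k]_m) : A *m X = 1%:M -> invmx A = X.
Proof.
move=> AX; have uA := (mulmx1_unit AX).1.
by rewrite -[LHS]mulmx1 -AX mulmxA mulVmx // mul1mx.
Qed.

(** Comparing values gives a_i as the combination of the b_j with coefficients P_ij, so the base
    change cancels and the operator depends only on the isometry class. *)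
Lemma pairing_op_iso m n (A : 'M[k]_m) (B : 'M[k]_n) a b :
  B^T = B -> B \in unitmx -> diag_lift A a -> diag_lift B b -> iso A B ->
  pairing_op a (invmx A) = pairing_op b (invmx B).
Proof.
move=> symB uB la lb [P [Q [PQ [QP PBP]]]].
have invA : invmx A = Q^T *m invmx B *m Q.
  apply: invmx_uniq; rewrite -PBP !mulmxA -[_ *m P^T *m Q^T]mulmxA -trmx_mul QP.
  by rewrite trmx1 mulmx1 -[P *m B *m _]mulmxA mulmxV // mulmx1.
have aE i : a i = \sum_j P i j *: b j.
  apply: (fmorph_inj iota); rewrite la -PBP rmorph_sum /=.
  transitivity ((row i P *m B *m (row i P)^T) 0 0).
    by rewrite mxE [RHS]mxE; apply: eq_bigr => j _; rewrite -row_mul !mxE.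
  by rewrite sym_quad //; apply: eq_bigr => j _; rewrite iotaZ lb !mxE.
apply/lfunP=> x; rewrite !pairing_opE invA.
have -> : \row_i s (x * a i) = \row_i s (x * b i) *m P^T.
  apply/rowP=> i; rewrite !mxE aE mulr_sumr s_sum; apply: eq_bigr => j _.
  by rewrite !mxE -scalerAr sZ mulrC.
rewrite !mulmxA -[_ *m P^T *m Q^T]mulmxA -trmx_mul QP trmx1 mulmx1.
set y := _ *m invmx B; under eq_bigr => i _ do rewrite aE scaler_sumr.
rewrite exchange_big /=; apply: eq_bigr => j _.
rewrite -[y in RHS]mulmx1 -QP mulmxA [in RHS]mxE scaler_suml.
by apply: eq_bigr => i _; rewrite scalerA.
Qed.

Lemma pairing_op_osum m n (A : 'M[k]_m) (B : 'M[k]_n) c :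
  A \in unitmx -> B \in unitmx ->
  pairing_op c (invmx (osum A B)) = pairing_op (fun i => c (lshift n i)) (invmx A) +
     pairing_op (fun i => c (rshift m i)) (invmx B).
Proof.
move=> uA uB.
have -> : invmx (osum A B) = block_mx (invmx A) 0 0 (invmx B).
  apply: invmx_uniq; rewrite mulmx_block !mulmx0 !mul0mx !addr0 !add0r.
  by rewrite !mulmxV // -scalar_mx_block.
apply/lfunP=> x; rewrite add_lfunE !pairing_opE big_split_ord /=.
have -> : \row_i s (x * c i) = row_mx (\row_i s (x * c (lshift n i)))
    (\row_i s (x * c (rshift m i))).
  apply/rowP=> i; rewrite !mxE; case: splitP => j ij; rewrite !mxE.
    by congr (s (x * c _)); apply: val_inj.
  by congr (s (x * c _)); apply: val_inj.
rewrite mul_row_block !mulmx0 addr0 add0r.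
by congr (_ + _); apply: eq_bigr => j _; rewrite ?row_mxEl ?row_mxEr.
Qed.

Lemma unitmx_osum m n (A : 'M[k]_m) (B : 'M[k]_n) :
  (osum A B \in unitmx) = (A \in unitmx) && (B \in unitmx).
Proof. by rewrite !unitmxE /osum det_ublock unitrM. Qed.

(** The map e sends a vector to its value lifted to M, so it kills the totally isotropic W. The
    coordinate row of T x is orthogonal to W, hence lies in W because W has half the dimension, and
    e sends it to T x. *)
Lemma pairing_op_metabolic m (A : 'M[k]_m) a :
  metabolic A -> diag_lift A a -> pairing_op a (invmx A) = 0.
Proof.
move=> [[symA uA] [W [rkW WAW]]] la.
pose e (z : 'rV[k]_m) : M := \sum_j z 0 j *: a j.
have e0 z : (z <= W)%MS -> e z = 0.
  case/submxP=> c ->; apply/eqP; rewrite -iota_eq0 rmorph_sum /=.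
  transitivity (((c *m W) *m A *m (c *m W)^T) 0 0 == 0).
    by rewrite sym_quad //; congr (_ == _); apply: eq_bigr => j _; rewrite iotaZ la.
  by rewrite trmx_mul !mulmxA -2!(mulmxA c) WAW mulmx0 mul0mx mxE eqxx.
apply/lfunP=> x; rewrite zero_lfunE pairing_opE; set y := \row_i _.
apply: (e0 _ _).
have kerE : (kermx (A *m W^T) <= W)%MS.
  have sWK : (W <= kermx (A *m W^T))%MS by apply/sub_kermxP; rewrite mulmxA.
  rewrite -(mxrank_leqif_sup sWK).
  have AW : (A *m W^T :=: W^T)%MS by apply: eqmxMfull; rewrite row_full_unit.
  by rewrite mxrank_ker AW mxrank_tr; apply/eqP; move: rkW; clear; lia.
apply: (submx_trans _ kerE); apply/sub_kermxP; rewrite mulmxA mulmxKV //.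
apply/trmx_inj; rewrite trmx_mul trmxK trmx0; apply/row_matrixP=> i.
rewrite row_mul row0; apply/rowP=> j; rewrite !ord1 !mxE.
transitivity (s (x * e (row i W))); last by rewrite e0 ?row_sub // mulr0 linear0.
rewrite /e mulr_sumr s_sum; apply: eq_bigr => l _.
by rewrite !mxE -scalerAr sZ.
Qed.

Lemma pairing_op_diag m (d : 'rV[k]_m) (b : 'I_m -> M) : (forall i, b i != 0) ->
  diag_lift (diag_mx d) b ->
  pairing_op b (invmx (diag_mx d)) = \sum_i rank1 (b i).
Proof.
move=> nzb lb; have dE i : d 0 i = iota (b i) by rewrite lb mxE eqxx.
have -> : invmx (diag_mx d) = diag_mx (\row_i (d 0 i)^-1).
  apply: invmx_uniq; apply/matrixP=> i j; rewrite mul_diag_mx !mxE.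
  case: eqP => [->|_]; last by rewrite mulr0n mulr0.
  by rewrite mulr1n dE mulfV // iota_eq0.
apply/lfunP=> x; rewrite pairing_opE sum_lfunE; apply: eq_bigr => j _.
by rewrite rank1E mul_mx_diag !mxE dE.
Qed.

Lemma pairing_op_basis m (B : 'M[k]_m) b : B^T = B -> B \in unitmx ->
  diag_lift B b -> free [tuple b i | i < m] ->
  [/\ normal_form (pairing_op b (invmx B)),
      limg (pairing_op b (invmx B)) = <<[tuple b i | i < m]>>%VS &
      forall i j, beta (pairing_op b (invmx B)) (b i) (b j) = B i j].
Proof.
move=> symB uB lb fb; set T := pairing_op _ _.
have nT : normal_form T by apply: normal_pairing.
have bs i : b i \in <<[tuple b i | i < m]>>%VS.
  by apply: memv_span; apply/mapP; exists i; rewrite ?mem_enum.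
pose S (x : M) : 'rV[k]_m := \row_i s (x * b i).
have Slin : linear S.
  by move=> c u v; apply/rowP=> i; rewrite !mxE mulrDl -scalerAl linearP.
have Ssurj r : exists x, S x = r.
  have : r \in limg (linfun S).
    have /eqP-> : (limg (linfun S) == fullv)%VS; last exact: memvf.
    rewrite eqEdim subvf /= dimvf dim_matrix.
    have := limg_ker_dim (linfun S) fullv; rewrite capfv.
    have : (\dim (lker (linfun S)) + \dim <<[tuple b i | i < m]>> <= \dim {:M})%N.
      apply: perp_dim => x y; rewrite memv_ker linfun_linE // => /eqP Sx.
      rewrite span_def big_map big_enum /= => /memv_sumP[z zl ->].
      rewrite mulr_sumr s_sum big1 // => i _; have /vlineP[c ->] := zl i isT.
      by rewrite -scalerAr sZ; move/rowP/(_ i): Sx; rewrite !mxE => ->; rewrite mulr0.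
    have -> : \dim <<[tuple b i | i < m]>> = m by move/eqP: fb; rewrite size_tuple.
    clear; dlia.
  by case/memv_imgP=> x _ ->; exists x; rewrite linfun_linE.
have TE i : exists2 x, T x = b i & S x = row i B.
  have [x Sx] := Ssurj (row i B); exists x => //.
  rewrite pairing_opE -/(S x) Sx -row_mul mulmxV // (bigD1 i) //= big1 => [|j ne].
    by rewrite !mxE eqxx scale1r addr0.
  by rewrite !mxE eq_sym (negPf ne) scale0r.
have imT : limg T = <<[tuple b i | i < m]>>%VS.
  apply: subv_anti; apply/andP; split.
    apply/subvP=> _ /memv_imgP[x _ ->]; rewrite pairing_opE.
    by apply: memv_suml => i _; rewrite memvZ.
  apply/span_subvP=> _ /mapP[i _ ->]; have [x <- _] := TE i.
  by rewrite memv_img ?memvf.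
split=> // i j; have [x Tx Sx] := TE i.
rewrite -{1}Tx betaE ?imT //; move/rowP/(_ j): Sx.
by rewrite !mxE.
Qed.

Lemma anisotropic_free m (B : 'M[k]_m) b : B^T = B -> anisotropic B ->
  diag_lift B b -> free [tuple b i | i < m].
Proof.
move=> symB anB lb; apply/freeP=> d d0 i; apply/eqP/negPn/negP=> nzd.
have nz : \row_j d j != 0.
  by apply: contraNneq nzd => /rowP/(_ i); rewrite !mxE => ->.
have /eqP[] := anB _ nz; rewrite sym_quad //.
transitivity (iota (\sum_(j < m) d j *: [tuple b i | i < m]`_j)).
  rewrite rmorph_sum; apply: eq_bigr => j _.
  by rewrite /= nth_mktuple iotaZ lb mxE.
by rewrite d0 rmorph0.
Qed.

Lemma iso_of_pairing_op m n (B : 'M[k]_m) (C : 'M[k]_n) b c : m = n ->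
  symform B -> anisotropic B -> symform C -> diag_lift B b -> diag_lift C c ->
  pairing_op b (invmx B) = pairing_op c (invmx C) -> iso B C.
Proof.
move=> mn [symB uB] anB [symC uC] lb lc; case: n / mn C symC uC c lc => C symC uC c lc.
set T := pairing_op b _ => TE.
have fb := anisotropic_free symB anB lb.
have [nT imT bT] := pairing_op_basis symB uB lb fb.
have dT : \dim (limg T) = m by rewrite imT; move/eqP: fb; rewrite size_tuple.
(* The common operator has rank m, which forces the m vectors c_i spanning its image to be
   independent. *)
have fc : free [tuple c i | i < m].
  rewrite /free eqn_leq dim_span size_tuple -[X in (X <= _)%N]dT TE.
  apply: dimvS; apply/subvP=> _ /memv_imgP[x _ ->]; rewrite pairing_opE.
  apply: memv_suml => i _; rewrite memvZ // memv_span //.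
  by apply/mapP; exists i; rewrite ?mem_enum.
have [_ imC bC] := pairing_op_basis symC uC lc fc.
rewrite -TE in imC bC.
pose P := \matrix_(i, j) coord [tuple c i | i < m] j (b i).
pose Q := \matrix_(i, j) coord [tuple b i | i < m] j (c i).
have mem_tuple (e : 'I_m -> M) i : e i \in <<[tuple e i | i < m]>>%VS.
  by apply: memv_span; apply/mapP; exists i; rewrite ?mem_enum.
have bE i : b i = \sum_j P i j *: c j.
  have := mem_tuple b i; rewrite -imT imC => /coord_span {1}->.
  by apply: eq_bigr => j _; rewrite nth_mktuple mxE.
have cE i : c i = \sum_j Q i j *: b j.
  have := mem_tuple c i; rewrite -imC imT => /coord_span {1}->.
  by apply: eq_bigr => j _; rewrite nth_mktuple mxE.
have inv (X Y : 'M[k]_m) (e f : 'I_m -> M) : free [tuple e i | i < m] ->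
    (forall i, e i = \sum_j X i j *: f j) -> (forall i, f i = \sum_j Y i j *: e j) ->
    X *m Y = 1%:M.
  move=> fe eE fE; apply/matrixP=> i j.
  have := coord_free i j fe; rewrite nth_mktuple {1}eE linear_sum !mxE => <-.
  rewrite [RHS](_ : _ = \sum_l X i l * Y l j); last first.
    apply: eq_bigr => l _; rewrite linearZ /= {1}fE linear_sum (bigD1 j) //=.
    rewrite linearZ /= -{1}(nth_mktuple e 0 j) coord_free // eqxx mulr1 big1 ?addr0 //.
    move=> l' ne; rewrite linearZ /= -{1}(nth_mktuple e 0 l') coord_free //.
    by rewrite (negPf ne) mulr0.
  by [].
exists P, Q; split; first exact: inv fb bE cE.
split; first exact: inv fc cE bE.
apply/matrixP=> i j; rewrite -bT (bE i) (bE j) beta_sumr mxE.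
apply: eq_bigr => l _; rewrite betaZr !mxE mulrC; congr (_ * _).
rewrite /beta linear_sum mulr_suml s_sum; apply: eq_bigr => l' _.
by rewrite linearZ -scalerAl sZ -/(beta _ _ _) bC.
Qed.

Definition bit_prod n (a : 'I_n -> M) (i : nat) : M :=
  \prod_(j < n | odd (i %/ 2 ^ j)) a j.

(** Splitting indices by their top bit peels off the last slot, which is the outermost factor of the
    fold; hence [rev]. *)
Lemma sum_bit_prod n (a : 'I_n -> M) T :
  \sum_(i < 2 ^ n) conj (bit_prod a i) T =
  pfister_op (rev [seq a j | j <- enum 'I_n]) T.
Proof.
case: n a => [|n] a.
  by rewrite big_ord1 /bit_prod big_ord0 conj1 enum_ord0.
(* Slots are extended to all natural numbers so that the induction on n need not change their
   type. *)
pose f j := a (inord j); have fE (j : 'I_n.+1) : a j = f j by rewrite /f inord_val.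
have -> : [seq a j | j <- enum 'I_n.+1] = [seq f j | j <- seq.iota 0 n.+1].
  by rewrite -val_enum_ord -map_comp; apply: eq_map.
under eq_bigr => i _ do
  (rewrite /bit_prod; under eq_bigr => j _ do rewrite fE).
elim: n.+1 f {fE} => [|m IHm] f.
  by rewrite big_ord1 big_ord0 conj1.
have -> : seq.iota 0 m.+1 = rcons (seq.iota 0 m) m by rewrite -addn1 seq.iotaD cats1.
rewrite map_rcons rev_rcons /= -IHm.
rewrite (big_halves _ m (fun i => conj (\prod_(j < m.+1 | odd (i %/ 2 ^ j)) f j) T)).
congr (_ + _).
  by apply: eq_bigr => i _; rewrite bits_prod_low.
have -> : conj (f m) (\sum_(i < 2 ^ m) conj (\prod_(j < m | odd (i %/ 2 ^ j)) f j) T) =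
    \sum_(i < 2 ^ m) conj (f m) (conj (\prod_(j < m | odd (i %/ 2 ^ j)) f j) T).
  by elim/big_rec2: _ => [|i x y _ <-]; rewrite ?conj0 ?conjD.
by apply: eq_bigr => i _; rewrite bits_prod_high // conjM.
Qed.

Lemma iota_bit_prod n (a : 'I_n -> M) i :
  iota (bit_prod a i) = \prod_(j < n | odd (i %/ 2 ^ j)) iota (a j).
Proof. exact: rmorph_prod. Qed.

Lemma bit_prod_neq0 n (a : 'I_n -> M) i : (forall j, a j != 0) -> bit_prod a i != 0.
Proof. by move=> nza; apply/prodf_neq0. Qed.

Lemma Ipow_sum I r (P : pred I) n (T : I -> 'End(M)) :
  (forall i, P i -> Ipow n (T i)) -> Ipow n (\sum_(i <- r | P i) T i).
Proof. by move=> IT; elim/big_ind: _ => //; [apply: Ipow_zero | apply: Ipow_add]. Qed.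

Lemma Ipow_bit_prod n (a : 'I_n -> M) (b : M) : (forall j, a j != 0) -> b != 0 ->
  Ipow n (\sum_(i < 2 ^ n) rank1 (bit_prod a i * b)).
Proof.
move=> nza nzb; under eq_bigr => i _ do rewrite -conj_rank1.
rewrite sum_bit_prod; set xs := rev _.
have -> : n = (size xs + 0)%N by rewrite size_rev size_map size_enum_ord addn0.
apply: Ipow_pfister; last exact: Ipow_rank1.
by rewrite all_rev; apply/allP=> _ /mapP[j _ ->].
Qed.

Lemma Ipow_of_in_In n m (B : 'M[k]_m) b q (c : 'I_q -> M) (a : 'I_q -> 'I_n -> M)
    m1 m2 (M1 : 'M[k]_m1) (M2 : 'M[k]_m2) e1 e2 :
  B \in unitmx -> diag_lift B b ->
  (forall i, c i != 0) -> (forall i j, a i j != 0) ->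
  metabolic M1 -> metabolic M2 -> diag_lift M1 e1 -> diag_lift M2 e2 ->
  iso (osum B M1) (osum (mxdiag (fun i => iota (c i) *: pfister (fun j => iota (a i j)))) M2) ->
  Ipow n (pairing_op b (invmx B)).
Proof.
move=> uB lb nzc nza met1 met2 l1 l2.
have [[symM1 uM1] _] := met1; have [[symM2 uM2] _] := met2.
pose d i : 'rV_(2 ^ n) := \row_l iota (bit_prod (a i) l * c i).
have -> : mxdiag (fun i => iota (c i) *: pfister (fun j => iota (a i j))) =
    mxdiag (fun i => diag_mx (d i)).
  apply: eq_mxdiag => i; rewrite /pfister -linearZ /=; congr diag_mx.
  by apply/rowP=> l; rewrite !mxE rmorphM /= iota_bit_prod mulrC.
rewrite mxdiag_diag; set dd := \row_l _; set C := diag_mx dd => isoBC.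
pose f (l : 'I_(\sum_(i < q) 2 ^ n)%N) : M :=
  bit_prod (a (tagnat.sig1 l)) (tagnat.sig2 l) * c (tagnat.sig1 l).
have nzf l : f l != 0 by rewrite mulf_neq0 ?bit_prod_neq0.
have lC : diag_lift C f by move=> l; rewrite !mxE eqxx.
have uC : C \in unitmx by apply: diag_mx_unit => l; rewrite !mxE iota_eq0 nzf.
pose join m' (g : 'I_m' -> M) m'' (h : 'I_m'' -> M) i :=
  match split i with inl i => g i | inr i => h i end.
have joinl m' (g : 'I_m' -> M) m'' (h : 'I_m'' -> M) i : join m' g m'' h (lshift m'' i) = g i.
  by rewrite /join (unsplitK (inl i)).
have joinr m' (g : 'I_m' -> M) m'' (h : 'I_m'' -> M) i : join m' g m'' h (rshift m' i) = h i.
  by rewrite /join (unsplitK (inr i)).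
have joinP m' (A : 'M[k]_m') g m'' (A' : 'M[k]_m'') h :
    diag_lift A g -> diag_lift A' h -> diag_lift (osum A A') (join m' g m'' h).
  move=> lA lA' i; case: (split_ordP i) => i' ->.
    by rewrite joinl lA block_mxEul.
  by rewrite joinr lA' block_mxEdr.
have pairing_ext m' (g g' : 'I_m' -> M) H : g =1 g' -> pairing_op g H = pairing_op g' H.
  move=> gg; apply/lfunP=> x; rewrite !pairing_opE.
  have -> : \row_i s (x * g i) = \row_i s (x * g' i) by apply/rowP=> i; rewrite !mxE gg.
  by apply: eq_bigr => i _; rewrite gg.
have symCM : (osum C M2)^T = osum C M2.
  by rewrite tr_block_mx !trmx0 tr_diag_mx symM2.
have uCM : osum C M2 \in unitmx by rewrite unitmx_osum uC uM2.
have := pairing_op_iso symCM uCM (joinP _ _ _ _ _ _ lb l1) (joinP _ _ _ _ _ _ lC l2) isoBC.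
rewrite !pairing_op_osum //.
rewrite !(pairing_ext _ _ _ _ (joinl _ _ _ _)) !(pairing_ext _ _ _ _ (joinr _ _ _ _)).
rewrite !(pairing_op_metabolic met1 l1) !(pairing_op_metabolic met2 l2) !addr0 => ->.
rewrite pairing_op_diag //.
have -> : \sum_l rank1 (f l) = \sum_i \sum_(j < 2 ^ n) rank1 (bit_prod (a i) j * c i).
  by rewrite sig_big_dep /= (reindex _ tagnat.sig_bij_on).
by apply: Ipow_sum => i _; apply: Ipow_bit_prod.
Qed.
End InseparableField.

(** * Choice of the field M and the forward implication *)

(** The tower starts from M = F with iota the Frobenius. A missing b is adjoined as a root of X^2 -
    b%:A, whose constant term iota maps to b^2; a root x already in M would satisfy iota x = b,
    since the Frobenius is injective. *)
Lemma inseparable_ext_exists (F : fieldType) (charF : 2%N \in [pchar F]) (S : seq F) :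
  exists (M : fieldExtType F) (iota : {rmorphism M -> F}),
    (forall x : M, x * x = (iota x)%:A) /\
    (forall b, b \in S -> exists m, iota m = b).
Proof.
suff [M [iota [iotaA iotaS]]] : exists (M : fieldExtType F) (iota : {rmorphism M -> F}),
    (forall c : F, iota c%:A = c ^+ 2) /\ (forall b, b \in S -> exists m, iota m = b).
  exists M, iota; split=> // x; apply: (fmorph_inj iota).
  by rewrite iotaA rmorphM expr2.
elim: S => [|b S [M [iota [iotaA iotaS]]]].
  exists (F^o : fieldExtType F).
  exists (pFrobenius_aut charF : {rmorphism F^o -> F}); split=> // c.
  by change ((c * 1 : F) ^+ 2 = c ^+ 2); rewrite mulr1.
have [[m mb] | nb] := classic (exists m, iota m = b).
  by exists M, iota; split=> // c; rewrite inE => /predU1P[-> | /iotaS]; first by exists m.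
pose p : {poly M} := 'X^2 - (b%:A)%:P.
have sp : size p = 3 by rewrite size_XnsubC.
have pz : root (map_poly iota p) b.
  by rewrite /root rmorphB /= map_polyXn map_polyC /= !hornerE iotaA subrr.
have nzp : p != 0 by rewrite -size_poly_eq0 sp.
have irr : irreducible_poly p.
  apply: cubic_irreducible; rewrite ?sp // => x; apply/negP.
  rewrite /root !hornerE subr_eq0 => /eqP xb; apply: nb; exists x.
  apply: (fmorph_inj (pFrobenius_aut charF)); rewrite /= !pFrobenius_autE.
  by rewrite -(iotaA b) -xb rmorphXn.
pose L : fieldExtType M := SubFieldExtType pz irr.
pose M' : fieldExtType F := baseFieldType L.
pose iota' : {rmorphism M' -> F} := (@subfx_inj _ _ iota b p : {rmorphism _ -> F}).
have iota'M x : iota' (x%:A : L) = iota x by apply: (subfx_inj_base pz nzp).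
exists M', iota'; split=> [c | d].
  have -> : (c%:A : M') = ((c%:A : M)%:A : L) by rewrite baseField_scaleE.
  by rewrite iota'M iotaA.
rewrite inE => /predU1P[-> | /iotaS[m <-]]; last by exists (m%:A : L); apply: iota'M.
by exists (subfx_root iota b p); apply: (subfx_inj_root pz nzp).
Qed.

(** The powers of t are distinct: t^m = 1 with m odd makes t = t^(m+1) a square, and an even m can
    be halved by injectivity of the Frobenius. *)
Lemma nonsquare_infinite (F : fieldType) (charF : 2%N \in [pchar F]) (t : F) :
  (forall c, t != c ^+ 2) -> forall p : {poly F}, p != 0 -> exists c, p.[c] != 0.
Proof.
move=> nsq p nzp; apply: NNPP => nex.
have root_p c : root p c by apply/negPn/negP=> pc; apply: nex; exists c.
have pow_neq1 m : (0 < m)%N -> t ^+ m != 1.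
  have [q] := ubnP m; elim: q m => // q IHq m le_m m0; apply/eqP=> tm.
  have [odd_m | ev_m] := boolP (odd m).
    have /negP[] := nsq (t ^+ m.+1./2); apply/eqP.
    have mE : (m.+1./2 * 2)%N = m.+1.
      by rewrite muln2 -[RHS]odd_double_half /= odd_m.
    by rewrite -exprM mE exprS tm mulr1.
  have mE : m = (m./2 * 2)%N by rewrite muln2 -[LHS]odd_double_half (negPf ev_m).
  have /negP[] : t ^+ m./2 != 1 by apply: IHq; lia.
  apply/eqP/(fmorph_inj (pFrobenius_aut charF)); rewrite /= !pFrobenius_autE.
  by rewrite -exprM -mE tm expr1n.
have nzt : t != 0 by have := nsq 0; rewrite expr0n.
have := max_poly_roots nzp (rs := [seq t ^+ i | i <- iota 0 (size p)]).
rewrite size_map size_iota ltnn => H; suff : false by [].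
apply: H; first by apply/allP.
rewrite map_inj_in_uniq ?iota_uniq // => i j _ _.
wlog lt_ij : i j / (i <= j)%N.
  by move=> W; case: (leqP i j) => [|/ltnW] le E; [apply: W | apply/esym/W].
move=> E; apply/eqP; rewrite eqn_leq lt_ij leqNgt; apply/negP=> lt.
have /negP[] : t ^+ (j - i) != 1 by apply: pow_neq1; rewrite subn_gt0.
apply/eqP/(mulfI (expf_neq0 i nzt)).
by rewrite -exprD subnKC // mulr1 E.
Qed.

Lemma scalar_exists (F : fieldType) (M : fieldExtType F) :
  exists s : {scalar M}, exists u, s u != 0.
Proof.
pose e := vbasis {:M}; have d0 : (0 < \dim {:M})%N by apply: adim_gt0.
exists (coord e (Ordinal d0)), e`_(Ordinal d0).
have E := coord_free (Ordinal d0) (Ordinal d0) (basis_free (vbasisP {:M})).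
by apply/eqP=> /(etrans (esym E))/eqP; rewrite eqxx oner_eq0.
Qed.

Lemma in_In_decomposition (F : fieldType) (charF : 2%N \in [pchar F]) n
    (B : 'M[F]_(2 ^ n.+2 + 2 ^ n.+1)) :
  symform B -> anisotropic B -> in_In n.+2 B ->
  exists (a : 'I_n -> F) (D : 'M[F]_6),
    (forall j, a j != 0) /\ albert D /\ iso B (pfister a *t D).
Proof.
move=> sB anB [q [sc [a [nzsc [nza [m1 [m2 [M1 [M2 [met1 [met2 isoBC]]]]]]]]]]].
have [symB uB] := sB.
pose S := [seq B i i | i <- enum 'I_(2 ^ n.+2 + 2 ^ n.+1)] ++ [seq sc i | i <- enum 'I_q] ++
  [seq a i j | i <- enum 'I_q, j <- enum 'I_n.+2] ++
  [seq M1 i i | i <- enum 'I_m1] ++ [seq M2 i i | i <- enum 'I_m2].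
have [M [iota [iotaP iotaS]]] := inseparable_ext_exists charF S.
have [b lb] : exists b : 'I_(2 ^ n.+2 + 2 ^ n.+1) -> M, forall i, iota (b i) = B i i.
  apply: (fin_all_exists (U := fun=> M) (P := fun i m => iota m = B i i)) => i; apply: iotaS.
  by rewrite /S !mem_cat (map_f (fun i => B i i)) ?mem_enum.
have [c lc] : exists c : 'I_q -> M, forall i, iota (c i) = sc i.
  apply: (fin_all_exists (U := fun=> M) (P := fun i m => iota m = sc i)) => i; apply: iotaS.
  by rewrite /S !mem_cat (map_f sc) ?mem_enum ?orbT.
have [al la] : exists al : 'I_q -> 'I_n.+2 -> M, forall i j, iota (al i j) = a i j.
  apply: (fin_all_exists (U := fun=> 'I_n.+2 -> M)
    (P := fun i f => forall j, iota (f j) = a i j)) => i.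
  apply: (fin_all_exists (U := fun=> M) (P := fun j m => iota m = a i j)) => j.
  apply: iotaS; rewrite /S !mem_cat (allpairs_f a) ?mem_enum ?orbT //.
have [e1 l1] : exists e : 'I_m1 -> M, forall i, iota (e i) = M1 i i.
  apply: (fin_all_exists (U := fun=> M) (P := fun i m => iota m = M1 i i)) => i; apply: iotaS.
  by rewrite /S !mem_cat (map_f (fun i => M1 i i)) ?mem_enum ?orbT.
have [e2 l2] : exists e : 'I_m2 -> M, forall i, iota (e i) = M2 i i.
  apply: (fin_all_exists (U := fun=> M) (P := fun i m => iota m = M2 i i)) => i; apply: iotaS.
  by rewrite /S !mem_cat (map_f (fun i => M2 i i)) ?mem_enum ?orbT.
have [s s_neq0] := scalar_exists M.
have nz_iota x : iota x != 0 -> x != 0 by rewrite fmorph_eq0.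
pose T := pairing_op s b (invmx B).
have IT : Ipow iota s n.+2 T.
  apply: (Ipow_of_in_In iotaP charF s (c := c) (a := al) uB lb _ _ met1 met2 l1 l2).
  - by move=> i; apply: nz_iota; rewrite lc.
  - by move=> i j; apply: nz_iota; rewrite la.
  have -> // : mxdiag (fun i => iota (c i) *: pfister (fun j => iota (al i j))) =
      mxdiag (fun i => sc i *: pfister (a i)).
  apply: eq_mxdiag => i; rewrite lc /pfister; congr (_ *: diag_mx _).
  by apply/rowP=> l; rewrite !mxE; apply: eq_bigr => j _; rewrite la.
have fb := anisotropic_free iotaP charF symB anB lb.
have [nT imT _] := pairing_op_basis iotaP charF s_neq0 symB uB lb fb.
have rkT : \dim (limg T) = (2 ^ n.+2 + 2 ^ n.+1)%N.
  by rewrite imT; move/eqP: fb; rewrite size_tuple.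
(* As rk T > 1, M is larger than its scalars, and iota maps an element outside them to a nonsquare
   of F. *)
have F_infinite : forall p : {poly F}, p != 0 -> exists c, p.[c] != 0.
  have /subvPn[x _ nx] : ~~ ({:M} <= 1)%VS.
    apply/negP=> /dimvS; rewrite dimv1 => le.
    have := leq_trans (dimvS (subvf (limg T))) le; rewrite rkT !expnS.
    by have := expn_gt0 2 n; clear; lia.
  apply: (nonsquare_infinite charF (t := iota x)) => d; apply: contra nx => /eqP xd.
  have : x * x = d%:A * d%:A by rewrite iotaP xd -scalerAl mul1r scalerA expr2.
  move/eqP; rewrite -!expr2 -subr_eq0.
  have charM : 2%N \in [pchar M] by rewrite pchar_lalg.
  rewrite -!(pFrobenius_autE charM) -rmorphB fmorph_eq0 subr_eq0 => /eqP->.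
  by rewrite memvZ ?mem1v.
have rk32 : (2 * \dim (limg T) = 3 * 2 ^ n.+2)%N.
  by rewrite rkT !expnS; clear; lia.
have [cs [w [x1 [y1 [x2 [y2 [nzcs szcs nzl TE]]]]]]] :=
  Ipow_shape iotaP charF s_neq0 F_infinite IT rk32.
pose ds := [:: x1 * w; y1 * w; x1 * y1 * w; x2 * w; y2 * w; x2 * y2 * w].
pose av (j : 'I_n) : M := (rev cs)`_j.
pose dv (j : 'I_6) : M := ds`_j.
have nzav j : av j != 0.
  by apply: (allP nzcs); rewrite -mem_rev mem_nth // size_rev szcs.
have nzdv j : dv j != 0.
  have : all (fun x => x != 0) ds.
    by move: nzl; rewrite /= !mulf_eq0 !negb_or => /and5P[-> -> -> -> /andP[-> _]].
  by move/allP; apply; rewrite mem_nth.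
pose D := diag_mx (\row_(j < 6) iota (dv j)).
exists (fun j => iota (av j)), D; split; first by move=> j; rewrite fmorph_eq0.
have uD : D \in unitmx by apply: diag_mx_unit => j; rewrite mxE fmorph_eq0.
split.
  split; first by split; rewrite ?tr_diag_mx.
  (* The product of the six entries is w^6 (x1 y1 x2 y2)^2. *)
  exists (iota (w ^+ 3 * (x1 * y1 * x2 * y2))).
  rewrite det_diag -rmorphXn; transitivity (iota (\prod_j dv j)).
    by rewrite rmorph_prod; apply: eq_bigr => j _; rewrite mxE.
  congr (iota _); rewrite !big_ord_recl big_ord0 /dv /=; ring.
have CE : pfister (fun j => iota (av j)) *t D =
    diag_mx (\row_l iota (bit_prod av (mxtens_unindex l).1 * dv (mxtens_unindex l).2)).
  rewrite tens_diag; congr diag_mx; apply/rowP=> l.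
  by rewrite !mxE rmorphM /= iota_bit_prod.
pose f (l : 'I_(2 ^ n * 6)) : M := bit_prod av (mxtens_unindex l).1 * dv (mxtens_unindex l).2.
have nzf l : f l != 0 by rewrite mulf_neq0 ?bit_prod_neq0.
rewrite CE; set dd := \row_l _.
have lf : diag_lift iota (diag_mx dd) f by move=> l; rewrite !mxE eqxx.
apply: (iso_of_pairing_op iotaP charF s_neq0 _ sB anB _ lb lf).
- by rewrite !expnS; clear; lia.
- split; first by rewrite tr_diag_mx.
  by apply: diag_mx_unit => l; rewrite mxE fmorph_eq0; apply: nzf.
rewrite (pairing_op_diag s nzf lf) -/T TE.
transitivity (\sum_(j < 6) \sum_(i < 2 ^ n) rank1 iota s (bit_prod av i * dv j)).
  have <- : \sum_(j < 6) rank1 iota s (dv j) = \sum_(d <- ds) rank1 iota s d.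
    by rewrite [RHS](big_nth 0) [RHS]big_mkord.
  have -> : cs = rev [seq av j | j <- enum 'I_n].
    rewrite -[LHS]revK; congr rev; apply: (@eq_from_nth _ 0).
      by rewrite size_map size_enum_ord size_rev.
    move=> i; rewrite size_rev szcs => lt_i.
    by rewrite (nth_map (Ordinal lt_i)) ?size_enum_ord // /av nth_enum_ord.
  have -> : pfister_op (rev [seq av j | j <- enum 'I_n]) (\sum_(j < 6) rank1 iota s (dv j)) =
      \sum_(j < 6) pfister_op (rev [seq av j | j <- enum 'I_n]) (rank1 iota s (dv j)).
    elim/big_rec2: _ => [|j x y _ <-]; last by rewrite pfister_opD.
    by elim: (rev _) => //= x xs ->; rewrite conj0 addr0.
  apply: eq_bigr => j _; rewrite -sum_bit_prod.
  by apply: eq_bigr => i _; rewrite conj_rank1.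
rewrite exchange_big pair_big /=.
rewrite (reindex (@mxtens_unindex (2 ^ n) 6)) /=; first by [].
by exists (@mxtens_index (2 ^ n) 6) => ? _; [apply: mxtens_unindexK | apply: mxtens_indexK].
Qed.

(** * Diagonal forms *)

Lemma anisotropic_diag (F : fieldType) (charF : 2%N \in [pchar F]) m (D : 'M[F]_m) :
  symform D -> anisotropic D ->
  exists2 d : 'rV[F]_m, (forall i, d 0 i != 0) & iso D (diag_mx d).
Proof.
move=> sD anD; have [symD uD] := sD.
have [M [iota [iotaP iotaS]]] := inseparable_ext_exists charF [seq D i i | i <- enum 'I_m].
have [b lb] : exists b : 'I_m -> M, forall i, iota (b i) = D i i.
  apply: (fin_all_exists (U := fun=> M) (P := fun i x => iota x = D i i)) => i; apply: iotaS.
  by rewrite (map_f (fun i => D i i)) ?mem_enum.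
have [s s_neq0] := scalar_exists M.
have fb := anisotropic_free iotaP charF symD anD lb.
have [nT imT _] := pairing_op_basis iotaP charF s_neq0 symD uD lb fb.
have [ds [nzds szds TE]] := normal_form_diag iotaP charF s_neq0 nT.
have szm : size ds = m by rewrite szds imT; move/eqP: fb; rewrite size_tuple.
pose c (i : 'I_m) : M := ds`_i.
have nzc i : c i != 0 by apply: (allP nzds); rewrite mem_nth ?szm.
pose d := \row_(i < m) iota (c i).
have nzd i : d 0 i != 0 by rewrite mxE fmorph_eq0.
have lc : diag_lift iota (diag_mx d) c by move=> i; rewrite !mxE eqxx.
exists d => //; apply: (iso_of_pairing_op iotaP charF s_neq0 (erefl m) sD anD _ lb lc).
  by split; [rewrite tr_diag_mx | apply: diag_mx_unit].
by rewrite (pairing_op_diag s nzc lc) TE (big_nth 0) szm big_mkord.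
Qed.

Lemma iso_trans (F : fieldType) m n p (A : 'M[F]_m) (B : 'M[F]_n) (C : 'M[F]_p) :
  iso A B -> iso B C -> iso A C.
Proof.
move=> [P [Q [PQ [QP <-]]]] [P' [Q' [PQ' [QP' <-]]]]; exists (P *m P'), (Q' *m Q).
split; first by rewrite mulmxA -(mulmxA P) PQ' mulmx1.
split; first by rewrite mulmxA -(mulmxA Q') QP mulmx1.
by rewrite trmx_mul !mulmxA.
Qed.

Lemma iso_osum (F : fieldType) m n p (A : 'M[F]_m) (B : 'M[F]_n) (C : 'M[F]_p) :
  iso A B -> iso (osum A C) (osum B C).
Proof.
move=> [P [Q [PQ [QP <-]]]].
exists (block_mx P 0 0 1%:M), (block_mx Q 0 0 1%:M); rewrite tr_block_mx !mulmx_block.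
by rewrite !(mulmx0, mul0mx, addr0, add0r, mulmx1, mul1mx, trmx0, trmx1) PQ QP -!scalar_mx_block.
Qed.

Lemma iso_tens (F : fieldType) m n p (A : 'M[F]_m) (B : 'M[F]_n) (C : 'M[F]_p) :
  iso A B -> iso (C *t A) (C *t B).
Proof.
have tens1 q r : 1%:M *t 1%:M = 1%:M :> 'M[F]_(q * r).
  rewrite -!diag_const_mx tens_diag; congr diag_mx.
  by apply/rowP=> l; rewrite !mxE mulr1.
move=> [P [Q [PQ [QP <-]]]]; exists (1%:M *t P), (1%:M *t Q).
by rewrite trmx_tens !tensmx_mul PQ QP trmx1 !mul1mx mulmx1 !tens1.
Qed.

Section SquareClasses.

Variable F : fieldType.

(** A chosen representative of the square class of x; equal classes give extensionally equal
    predicates, so epsilon returns the same element. *)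
Definition square_rep (x : F) : F :=
  epsilon (inhabits 0) (fun y => exists2 r, r != 0 & y = r ^+ 2 * x).

Lemma square_repP x : exists2 r, r != 0 & square_rep x = r ^+ 2 * x.
Proof.
apply: (epsilon_spec (inhabits 0) (fun y => exists2 r, r != 0 & y = r ^+ 2 * x)).
by exists x, 1; rewrite ?oner_neq0 // expr1n mul1r.
Qed.

Lemma square_repM r x : r != 0 -> square_rep (r ^+ 2 * x) = square_rep x.
Proof.
move=> nzr; rewrite /square_rep; congr (epsilon _ _).
apply: functional_extensionality => y; apply: propositional_extensionality.
split=> -[t nzt ->].
  by exists (t * r); rewrite ?mulf_neq0 // exprMn mulrA.
exists (t / r); first by rewrite mulf_neq0 ?invr_eq0.
by rewrite mulrA -exprMn divfK.
Qed.

(* Quantifying over class functions h instead of comparing multiplicities of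
   square classes turns isometries into manipulations of sums. *)
Lemma iso_diag m n (u : 'rV[F]_m) (v : 'rV[F]_n) :
  (forall h : F -> nat, (forall r x, r != 0 -> h (r ^+ 2 * x) = h x) ->
    (\sum_i h (u ord0 i) = \sum_j h (v ord0 j))%N) ->
  iso (diag_mx u) (diag_mx v).
Proof.
move=> huv; have mn : m = n.
  by have := huv (fun=> 1%N) (fun _ _ _ => erefl); rewrite !sum1_card !card_ord.
case: n / mn v huv => v huv.
pose s := [tuple square_rep (u 0 i) | i < m].
pose t := [tuple square_rep (v 0 i) | i < m].
(* Taking for h the indicator of a set of square classes shows that the classes occur with equal
   multiplicities. *)
have perm_st : perm_eq s t.
  apply/seq.permP=> a.
  have countE (w : 'rV[F]_m) : count a [tuple square_rep (w 0 i) | i < m] =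
      (\sum_i a (square_rep (w ord0 i)))%N.
    transitivity (count a [seq square_rep (w 0 i) | i <- enum 'I_m]).
      by congr (count a _); rewrite -val_ord_tuple.
    by rewrite count_map -sum1_count big_enum_cond /= big_mkcond.
  rewrite !countE; apply: (huv (fun x => a (square_rep x))) => r x nzr.
  by rewrite square_repM.
have /tuple_permP[p sE] := perm_st.
have up i : square_rep (u 0 i) = square_rep (v 0 (p i)).
  have : tnth s i = tnth [tuple tnth t (p i) | i < m] i by congr (tnth _ i); apply: val_inj.
  by rewrite !tnth_mktuple.
have [r rP] : exists r : 'I_m -> F, forall i, r i != 0 /\ u 0 i = r i ^+ 2 * v 0 (p i).
  apply: (fin_all_exists (U := fun=> F) (P := fun i r => r != 0 /\ _ = r ^+ 2 * _)) => i.
  have [a nza aE] := square_repP (u 0 i); have [b nzb bE] := square_repP (v 0 (p i)).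
  exists (b / a); split; first by rewrite mulf_neq0 ?invr_eq0.
  apply: (mulfI (expf_neq0 2 nza)); rewrite -aE up bE mulrA -exprMn.
  by rewrite [a * _]mulrC divfK.
exists (\matrix_(i, j) (r i *+ (j == p i))), (\matrix_(j, i) ((r i)^-1 *+ (j == p i))).
have one_term (j : 'I_m) (f : 'I_m -> F) (a : F) :
    \sum_k (a *+ (k == j)) * f k = a * f j.
  rewrite (bigD1 j) //= eqxx mulr1n big1 ?addr0 // => k /negPf->.
  by rewrite mulr0n mul0r.
split; first last.
  split; last first.
    apply/matrixP=> i j; rewrite !mxE.
    under eq_bigr => k _ do rewrite mul_mx_diag !mxE -mulrA.
    rewrite one_term mulrnAr mulrnAr (inj_eq perm_inj).
    case: eqP => [-> | _]; rewrite ?mulr0n // !mulr1n.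
    by have [_ ->] := rP j; rewrite expr2 mulrCA mulrC.
  apply/mulmx1C/matrixP=> i j; rewrite !mxE.
  under eq_bigr => k _ do rewrite !mxE.
  rewrite one_term mulrnAr (inj_eq perm_inj).
  by case: eqP => [-> | _] //; rewrite !mulr1n mulfV //; case: (rP j).
apply/matrixP=> i j; rewrite !mxE.
under eq_bigr => k _ do rewrite !mxE.
rewrite one_term mulrnAr (inj_eq perm_inj).
by case: eqP => [-> | _] //; rewrite !mulr1n mulfV //; case: (rP j).
Qed.

End SquareClasses.

(** * The converse implication *)

Lemma metabolic_double (F : fieldType) (charF : 2%N \in [pchar F]) m (A : 'M[F]_m) :
  symform A -> metabolic (osum A A).
Proof.
move=> [symA uA]; split.
  by split; [rewrite tr_block_mx !trmx0 symA | rewrite unitmx_osum uA].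
exists (block_mx 1%:M 1%:M 0 0); split; last first.
  rewrite tr_block_mx !trmx0 !mulmx_block !trmx1.
  rewrite !(mulmx0, mul0mx, addr0, add0r, mulmx1, mul1mx) -[RHS]block_mx0.
  congr block_mx; apply/matrixP=> i j; rewrite !mxE.
  exact: addrr_pchar2.
rewrite /block_mx row_mx0 rank_col_mx0 muln2 -addnn.
have /eqP-> // : row_free (row_mx 1%:M 1%:M : 'M[F]_(m, m + m)).
apply/row_freeP; exists (col_mx 1%:M 0).
by rewrite mul_row_col mulmx0 mulmx1 addr0.
Qed.

Lemma anisotropic_iso (F : fieldType) m n (A : 'M[F]_m) (B : 'M[F]_n) :
  iso A B -> anisotropic A -> anisotropic B.
Proof.
move=> [P [Q [PQ [QP PBP]]]] anA v nzv.
have -> : v *m B *m v^T = (v *m Q) *m A *m (v *m Q)^T.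
  rewrite -PBP trmx_mul !mulmxA -(mulmxA v Q P) QP mulmx1.
  by rewrite -(mulmxA _ P^T Q^T) -trmx_mul QP trmx1 mulmx1.
apply: anA; apply: contraNneq nzv => vQ0.
by rewrite -[v]mulmx1 -QP mulmxA vQ0 mul0mx.
Qed.

(** This makes the Albert form diagonalizable: in characteristic 2 a nonzero alternating form has no
    orthogonal basis, whereas anisotropic forms always have one. *)
Lemma anisotropic_pfister_tens (F : fieldType) n (a : 'I_n -> F) m (D : 'M[F]_m) :
  anisotropic (pfister a *t D) -> anisotropic D.
Proof.
move=> anC v nzv; pose i0 := Ordinal (expn_gt0 2 n : (0 < 2 ^ n)%N).
pose e : 'rV[F]_(2 ^ n) := delta_mx 0 i0.
have nz : (e *t v : 'rV_(2 ^ n * m)) != 0.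
  apply: contraNneq nzv => /matrixP ev; apply/eqP/rowP=> j.
  have := tensmxE e v ord0 ord0 i0 j.
  rewrite (_ : (e *t v) _ _ = 0) => [|]; first by rewrite !mxE !eqxx mul1r => <-.
  by have := ev (@mxtens_index 1 1 (ord0, ord0)) (mxtens_index (i0, j)); rewrite [RHS]mxE.
have E : (e *t v) *m (pfister a *t D) *m (e *t v)^T =
    (e *m pfister a *m e^T) *t (v *m D *m v^T).
  by rewrite trmx_tens !tensmx_mul.
have := anC _ nz; rewrite E.
have -> : (e *m pfister a *m e^T *t (v *m D *m v^T)) 0 0 =
    (e *m pfister a *m e^T) 0 0 * (v *m D *m v^T) 0 0.
  have := tensmxE (e *m pfister a *m e^T) (v *m D *m v^T) ord0 ord0 ord0 ord0.
  by move=> <-; congr (fun_of_matrix _ _ _); apply: val_inj.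
by rewrite mulf_eq0 negb_or => /andP[].
Qed.

Section PfisterSums.

Variables (F : fieldType) (h : F -> nat).

Lemma sum_tens_diag m n (u : 'I_m -> F) (v : 'I_n -> F) :
  (\sum_(l < m * n) h (u (mxtens_unindex l).1 * v (mxtens_unindex l).2) =
   \sum_(i < m) \sum_(j < n) h (u i * v j))%N.
Proof.
rewrite pair_big /= (reindex (@mxtens_unindex m n)) //=.
by exists (@mxtens_index m n) => ? _; [apply: mxtens_unindexK | apply: mxtens_indexK].
Qed.

Lemma sum_pfister2 n (f : nat -> F) c (p := fun i => \prod_(j < n | odd (i %/ 2 ^ j)) f j) :
  (\sum_(i < 2 ^ n.+2) h (c * \prod_(j < n.+2 | odd (i %/ 2 ^ j)%N) f j) =
   \sum_(i < 2 ^ n) (h (p i * c) + h (p i * (c * f n)) + h (p i * (c * f n.+1)) +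
                     h (p i * (c * f n * f n.+1))))%N.
Proof.
rewrite (big_halves _ n.+1 (fun i => h (c * \prod_(j < n.+2 | odd (i %/ 2 ^ j)) f j))) /=.
under eq_bigr => i _ do rewrite bits_prod_low //.
under [X in (_ + X)%N]eq_bigr => i _ do rewrite bits_prod_high //.
rewrite (big_halves _ n (fun i => h (c * \prod_(j < n.+1 | odd (i %/ 2 ^ j)) f j))) /=.
rewrite (big_halves _ n (fun i => h (c * (f n.+1 * \prod_(j < n.+1 | odd (i %/ 2 ^ j)) f j)))) /=.
rewrite -!big_split /=; apply: eq_bigr => i _.
rewrite !bits_prod_high ?bits_prod_low // -/(p i) addnA.
by congr (h _ + h _ + h _ + h _)%N; ring.
Qed.

End PfisterSums.

(* With D = <d0, ..., d5> and e = d0 d1 d2, D plus the metabolic form <e, e> is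
   d0 <<d0 d1, d0 d2>> + e <<e d3, e d4>>, as d5 and e d3 d4 agree up to squares. *)
Lemma decomposition_in_In (F : fieldType) (charF : 2%N \in [pchar F]) n m (B : 'M[F]_m)
    (a : 'I_n -> F) (D : 'M[F]_6) :
  anisotropic B -> (forall j, a j != 0) -> albert D ->
  iso B (pfister a *t D) -> in_In n.+2 B.
Proof.
move=> anB nza [sD [c detD]] isoB.
have anD : anisotropic D := anisotropic_pfister_tens (anisotropic_iso isoB anB).
have [d nzd isoD] := anisotropic_diag charF sD anD.
pose de (j : nat) := d ord0 (inord j : 'I_6).
have nzde j : de j != 0 by apply: nzd.
have dE (j : 'I_6) : d ord0 j = de j by rewrite /de inord_val.
have [C CE] : exists C, de 0%N * de 1%N * de 2%N * de 3%N * de 4%N * de 5%N = C ^+ 2.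
  have [P [Q [PQ [_ PDP]]]] := isoD.
  have nzP : \det P != 0.
    have := congr1 determinant PQ; rewrite det_mulmx det1 => PQ1.
    by apply: contra_eq_neq PQ1 => ->; rewrite mul0r eq_sym oner_neq0.
  exists (c / \det P); rewrite expr_div_n -detD -PDP !det_mulmx det_tr det_diag.
  rewrite !big_ord_recl big_ord0 !dE /= /bump /=; field; exact: nzP.
pose e := de 0%N * de 1%N * de 2%N.
have nze : e != 0 by rewrite !mulf_neq0.
have [r nzr de5] : exists2 r, r != 0 & de 5%N = r ^+ 2 * (e * de 3%N * de 4%N).
  have nzC : C != 0.
    by rewrite -sqrf_eq0 -CE !mulf_neq0.
  exists (C / (e * de 3%N * de 4%N)); first by rewrite mulf_neq0 ?invr_eq0 ?mulf_neq0.
  by rewrite expr_div_n -CE /e; field; rewrite ?nzde.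
pose af j := oapp a 1 (insub j).
have afE (j : 'I_n) : af j = a j by rewrite /af valK.
pose sc (t : 'I_2) := if t == ord0 then de 0%N else e.
pose x (t : 'I_2) := if t == ord0 then de 0%N * de 1%N else e * de 3%N.
pose y (t : 'I_2) := if t == ord0 then de 0%N * de 2%N else e * de 4%N.
pose f t j := if (j < n)%N then af j else if j == n then x t else y t.
have nzf t j : f t j != 0.
  rewrite /f /x /y /af; case: ifP => _; first by case: (insub j) => //= *; apply: oner_neq0.
  by do 2 case: ifP => _; rewrite ?mulf_neq0.
pose p i := \prod_(j < n | odd (i %/ 2 ^ j)) a j.
have nzp i : p i != 0 by apply/prodf_neq0.
pose A : 'M[F]_(2 ^ n) := diag_mx (\row_i (p i * e)).
have sA : symform A.
  split; first by rewrite tr_diag_mx.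
  by apply: diag_mx_unit => i; rewrite mxE mulf_neq0.
exists 2%N, sc, (fun t j => f t j); split; first by move=> t; rewrite /sc; case: ifP.
split; first by move=> t j; apply: nzf.
(* [osum A A] is the Pfister form tensored with <e, e>; the metabolic form on the other side is
   empty. *)
exists (2 ^ n + 2 ^ n)%N, 0%N, (osum A A), 0; split; first exact: metabolic_double.
split.
  split; first by split; [apply/matrixP=> -[] | rewrite unitmxE det_mx00 unitr1].
  by exists 0; rewrite mxrank0 mul0mx; split=> //; apply/matrixP=> -[].
pose g t : 'rV[F]_(2 ^ n.+2) :=
  \row_i (sc t * \prod_(j < n.+2 | odd (i %/ 2 ^ j)) f t j).
have -> : mxdiag (fun t : 'I_2 => sc t *: pfister (fun j : 'I_n.+2 => f t j)) =
    mxdiag (fun t => diag_mx (g t)).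
  apply: eq_mxdiag => t; rewrite /pfister -linearZ; congr diag_mx.
  by apply/rowP=> i; rewrite !mxE.
rewrite mxdiag_diag (_ : 0 = diag_mx (0 : 'rV[F]_0)); last by apply/matrixP=> -[].
apply: iso_trans (iso_osum _ (iso_trans isoB (iso_tens _ isoD))) _.
rewrite /pfister tens_diag /osum -!diag_mx_row; apply: iso_diag => h hsq.
rewrite !big_split_ord /= big_ord0 addn0.
under eq_bigr => l _ do rewrite row_mxEl !mxE.
under [X in (_ + (X + _))%N]eq_bigr => l _ do rewrite row_mxEr row_mxEl !mxE.
under [X in (_ + (_ + X))%N]eq_bigr => l _ do rewrite row_mxEr row_mxEr !mxE.
under [RHS]eq_bigr => l _ do rewrite row_mxEl mxE.
rewrite (sum_tens_diag h p (fun j => d ord0 j)).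
rewrite [RHS](_ : _ = \sum_(t < 2) \sum_(i < 2 ^ n.+2) h (g t ord0 i))%N; last first.
  by rewrite sig_big_dep /= (reindex _ tagnat.sig_bij_on).
under [RHS]eq_bigr => t _ do under eq_bigr => i _ do rewrite mxE.
rewrite [RHS](eq_bigr _ (fun t _ => sum_pfister2 h n (f t) (sc t))).
rewrite big_ord_recl big_ord1 -!big_split /=; apply: eq_bigr => i _.
have fn t : f t n = x t by rewrite /f ltnn eqxx.
have fn1 t : f t n.+1 = y t by rewrite /f ltnNge leqnSn /= gtn_eqF.
have pE t : \prod_(j < n | odd (i %/ 2 ^ j)) f t j = p i.
  by apply: eq_bigr => j _; rewrite /f ltn_ord afE.
rewrite !pE !fn !fn1 !big_ord_recl big_ord0 !dE /= /bump /= /sc /x /y /= addn0 !add1n.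
have h2 z z' q : q != 0 -> z = q ^+ 2 * z' -> h z = h z' by move=> nzq ->; apply: hsq.
rewrite (h2 (p i * (de 0%N * (de 0%N * de 1%N))) (p i * de 1%N) (de 0%N)) //; last by ring.
rewrite (h2 (p i * (de 0%N * (de 0%N * de 2%N))) (p i * de 2%N) (de 0%N)) //; last by ring.
rewrite (h2 (p i * (de 0%N * (de 0%N * de 1%N) * (de 0%N * de 2%N))) (p i * e) (de 0%N)) //;
  last by rewrite /e; ring.
rewrite (h2 (p i * (e * (e * de 3%N))) (p i * de 3%N) e) //; last by ring.
rewrite (h2 (p i * (e * (e * de 4%N))) (p i * de 4%N) e) //; last by ring.
rewrite (h2 (p i * de 5%N) (p i * (e * de 3%N * de 4%N)) r) //; last by rewrite de5; ring.
rewrite (h2 (p i * (e * (e * de 3%N) * (e * de 4%N))) (p i * (e * de 3%N * de 4%N)) e) //;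
  last by ring.
by rewrite !addnA; clear; lia.
Qed.

Theorem theorem1p3 (F : fieldType) (hF : 2%N \in [pchar F]) (n : nat)
  (hn : (2 <= n)%N) (B : 'M[F]_(2 ^ n + 2 ^ n.-1))
  (hB : symform B) (hanis : anisotropic B) :
  in_In n B <->
  exists (a : 'I_(n - 2) -> F) (D : 'M[F]_6),
    (forall j, a j != 0) /\ albert D /\ iso B (pfister a *t D).
Proof.
case: n hn B hB hanis => [|[|n]] // _ B hB hanis.
have -> : (n.+2 - 2 = n)%N by rewrite !subSS subn0.
split=> [/(in_In_decomposition hF hB hanis) // | [a [D [nza [albertD isoD]]]]].
exact: decomposition_in_In isoD.
Qed.
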